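(* Let $A$ be a scalar type spectral operator in a complex Banach space $X$. Then $A$ generates an immediately differentiable $C_0$-semigroup (of scalar type spectral operators) on $X$ if and only if there exists $\omega\in\mathbb{R}$ and, for every $b>0$, there exists $a\in\mathbb{R}$ such that $$\sigma(A)\subseteq\{\lambda\in\mathbb{C} : \operatorname{Re}\lambda\le\min(\omega,\,a-b\ln|\operatorname{Im}\lambda|)\}.$$
   Context: A scalar type spectral operator in a complex Banach space $X$ is a densely defined closed linear operator $A$ in $X$ for which there is a strongly $\sigma$-additive spectral measure $E_A(\cdot)$ (the resolution of the identity), assigning to Borel subsets of $\mathbb{C}$ bounded projection operators on $X$ (with $E_A(\emptyset)=0$, $E_A(\mathbb{C})=I$, $E_A(\delta\cap\delta')=E_A(\delta)E_A(\delta')$), whose support is the spectrum $\sigma(A)$, and such that $A=\int_{\sigma(A)}\lambda\,dE_A(\lambda)$. Here, for a Borel measurable $F:\sigma(A)\to\mathbb{C}$, $F(A)=\int_{\sigma(A)}F(\lambda)\,dE_A(\lambda)$ is the operator $F(A)f=\lim_{n\to\infty}\int_{\{|F|\le n\}}F(\lambda)\,dE_A(\lambda)f$, with domain all $f\in X$ for which the limit exists. A $C_0$-semigroup $\{T(t)\}_{t\ge 0}$ on $X$ is immediately differentiable if, for every $f\in X$, the orbit map $[0,\infty)\ni t\mapsto T(t)f\in X$ is differentiable on $(0,\infty)$. Convention: $\ln 0=-\infty$, so that for real $\lambda$ the minimum equals $\omega$. The number $\omega$ does not depend on $b$. *)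

(* Defs.v *)
From HB Require Import structures.
From mathcomp Require Import all_boot all_order all_algebra.
From mathcomp Require Import complex.
From mathcomp Require Import all_classical all_reals all_analysis.
Set Implicit Arguments.
Unset Strict Implicit.
Unset Printing Implicit Defensive.
Import Order.TTheory GRing.Theory Num.Theory.
Import numFieldNormedType.Exports.
Local Open Scope classical_set_scope.
Local Open Scope complex_scope.
Local Open Scope ring_scope.

(* A possibly unbounded operator [A] is its domain together with a total map;
   the values of that map outside [dom A] are irrelevant. *)
Record operator (X : Type) := Operator { dom : set X; app :> X -> X }.

Definition everywhere_defined (X : Type) (T : X -> X) : operator X :=
  Operator [set: X] T.

Section Operators.
Context {R : realType} {X : completeNormedModType R[i]}.
Implicit Types (A : operator X) (E : set R[i] -> X -> X).

Definition graph A : set (X * X) := [set p | dom A p.1 /\ A p.1 = p.2].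

Definition bounded_operator (T : X -> X) : Prop := linear T /\ continuous T.

Definition linear_operator A : Prop :=
  dom A 0 /\
  forall (c : R[i]) (x y : X), dom A x -> dom A y ->
    dom A (c *: x + y) /\ A (c *: x + y) = c *: A x + A y.

Definition densely_defined_closed_linear A : Prop :=
  [/\ linear_operator A, dense (dom A) & closed (graph A)].

Definition resolvent_set A : set R[i] :=
  [set z | exists2 S : X -> X, bounded_operator S &
    (forall y, dom A (S y) /\ A (S y) - z *: S y = y) /\
    (forall x, dom A x -> S (A x - z *: x) = x)].

Definition spectrum A : set R[i] := ~` resolvent_set A.

(* [R[i]^o] is [R[i]] with the topology of its norm. *)
Definition borel : set (set R[i]) := <<s [set U : set R[i]^o | open U] >>.

(* Strong sigma-additivity is convergence in norm for each vector.  That each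
   [E d] is a projection is the multiplicativity law with [d' = d].  Nothing is
   required of [E] outside the Borel sets. *)
Definition spectral_measure E : Prop :=
  [/\ forall d, borel d -> bounded_operator (E d),
      forall f, E set0 f = 0,
      forall f, E [set: R[i]] f = f,
      forall d d', borel d -> borel d' ->
        forall f, E (d `&` d') f = E d (E d' f) &
      forall d : (set R[i])^nat, (forall n, borel (d n)) ->
        trivIset [set: nat] d ->
        forall f, [series E (d n) f]_n @ \oo --> E (\bigcup_n d n) f].

Definition support E : set R[i] :=
  [set z | forall U : set R[i]^o, open U -> U z -> exists f, E U f <> 0].

(* A simple function is coded as a list of pairs (coefficient, Borel set); the
   sets may overlap. *)
Definition simple_fun (s : seq (R[i] * set R[i])) (z : R[i]) : R[i] :=
  \sum_(p <- s) p.1 * \1_(p.2) z.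

Definition simple_integral E (D : set R[i]) (s : seq (R[i] * set R[i]))
    (f : X) : X :=
  \sum_(p <- s) p.1 *: E (p.2 `&` D) f.

(* [y] is the integral over [D] of the function [F], bounded on [D], against
   the vector measure [E _ f]: the limit of the integrals of some (equivalently
   any) sequence of simple functions converging to [F] uniformly on [D]. *)
Definition is_bounded_integral E (D : set R[i]) (F : R[i] -> R[i])
    (f y : X) : Prop :=
  exists s : nat -> seq (R[i] * set R[i]),
    [/\ forall n p, p \in s n -> borel p.2,
        forall e : R, 0 < e -> \forall n \near \oo,
          forall z, D z -> `|F z - simple_fun (s n) z| <= e%:C &
        simple_integral E D (s n) f @[n --> \oo] --> y].

Definition is_spectral_integral E (D : set R[i]) (F : R[i] -> R[i])
    (f y : X) : Prop :=
  exists u : nat -> X,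
    (forall n, is_bounded_integral E
       (D `&` [set z | `|F z| <= n%:R]) F f (u n)) /\
    u @ \oo --> y.

(* The last clause is equality of unbounded operators: it identifies both the
   domain and the values of [A]. *)
Definition resolution_of_identity A E : Prop :=
  [/\ spectral_measure E, support E = spectrum A &
      forall f y, (dom A f /\ A f = y) <->
        is_spectral_integral E (spectrum A) id f y].

Definition scalar_type_spectral A : Prop :=
  densely_defined_closed_linear A /\ exists E, resolution_of_identity A E.

(* Only the values [T t] with [0 <= t] are meaningful. *)
Definition C0_semigroup (T : R -> X -> X) : Prop :=
  [/\ forall t, 0 <= t -> bounded_operator (T t),
      forall f, T 0 f = f,
      forall s t, 0 <= s -> 0 <= t -> forall f, T (s + t) f = T s (T t f) &
      forall f, T t f @[t --> 0^'+] --> f].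

Definition generates A (T : R -> X -> X) : Prop :=
  forall f y, (dom A f /\ A f = y) <->
    (t^-1)%:C *: (T t f - f) @[t --> 0^'+] --> y.

(* [derivable] does not apply: the orbits go from [R] to a normed module over
   [R[i]], so the limit of difference quotients is written out. *)
Definition immediately_differentiable (T : R -> X -> X) : Prop :=
  forall (f : X) (t : R), 0 < t ->
    cvg ((h^-1)%:C *: (T (t + h) f - T t f) @[h --> 0^']).

End Operators.

(* [lne 0 = -oo], so that a real [z] is only constrained by [omega]. *)
Definition log_region {R : realType} (omega a b : R) : set R[i] :=
  [set z | ((complex.Re z)%:E <=
     Order.min omega%:E (a%:E - b%:E * lne (`|complex.Im z|%:E)))%E].

(* Main.v *)
(* For a resolution of the identity E, countable additivity and uniform
   boundedness give a bound on all the projections E(d), hence a functional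
   calculus F |-> int F dE, bounded by K sup |F| and multiplicative on bounded
   Borel functions.  If A generates a semigroup T, then T(t) = int e^(tz) dE(z)
   on the range of E(D), for every bounded Borel subset D of the spectrum; so
   each z in the spectrum is an approximate eigenvalue of T(t), with e^(tz), and
   of (T(t+h) - T(t))/h, with (e^((t+h)z) - e^(tz))/h.  Boundedness of T(1), and
   of the difference quotients at t (which converge strongly), yields
   Re z <= omega and |z| e^(t Re z) <= C_t; the latter with t = 1/b is the
   logarithmic bound.  Conversely, under these bounds T(t) = int e^(tz) dE(z) is
   a semigroup generated by A, and |z|^2 e^(s Re z) is bounded on the spectrum
   for every s > 0, so that its orbits are differentiable.  Finally, T(t) is the
   integral of the identity against the image of E under z |-> e^(tz). *)
From HB Require Import structures.
Require Import Defs.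
From mathcomp Require Import all_boot all_order all_algebra.
From mathcomp Require Import complex.
From mathcomp Require Import all_classical all_reals all_analysis.
From mathcomp Require Import ring lra zify.
Set Implicit Arguments.
Unset Strict Implicit.
Unset Printing Implicit Defensive.
Import Order.TTheory GRing.Theory Num.Theory.
Import numFieldNormedType.Exports.
Local Open Scope classical_set_scope.
Local Open Scope complex_scope.
Local Open Scope ring_scope.

(** * Norms and uniform boundedness *)

(** Neither dual spaces nor integrals over time are used. The bound K sup |F| comes from convexity:
    a real simple function with values in [0, c] integrates to a vector in the convex hull of the c
    E(d) f, so a uniform bound on the projections suffices, whereas scalar measures and their
    variation would bring in functionals. Facts on semigroups usually read off from T(t)g - g =
    int_0^t T(s) A g ds are obtained by cutting [0, t] into n equal steps and letting n grow. On the
    range of E(D), with D bounded, A acts as a bounded operator and second-order expansions are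
    available. The rest of X is reached through truncations of the spectrum; what makes the
    generator survive this limit is the estimate |T(t)g - g| <= t M |Ag|, linear in t. In the
    converse the square |z|^2 is there to integrate the second-order remainder of e^(hz). Since b is
    arbitrary, b = 2/s controls the square of Im z; the exponential itself absorbs the square of a
    very negative Re z. *)

Definition nrm {R : realType} {V : normedZmodType R[i]} (x : V) : R :=
  complex.Re `|x|.

Section Norm.
Context {R : realType} {V : normedZmodType R[i]}.
Implicit Types x y : V.

(** The norm of a module over [R[i]] takes its values in [R[i]]. These are real, so [nrm] forgets
    nothing, and estimates become inequalities in [R] that [lra] and [nra] can handle. *)
Lemma nrmE x : `|x| = (nrm x)%:C.
Proof. by rewrite /nrm RRe_real. Qed.

Lemma nrm_ge0 x : 0 <= nrm x.
Proof. by rewrite -ler0c -nrmE. Qed.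

Lemma nrm0 : nrm (0 : V) = 0.
Proof. by rewrite /nrm normr0. Qed.

Lemma nrm_eq0 x : (nrm x == 0) = (x == 0).
Proof. by rewrite -[RHS]normr_eq0 nrmE -(inj_eq (@complexI R)). Qed.

Lemma nrm_gt0 x : (0 < nrm x) = (x != 0).
Proof. by rewrite lt_neqAle nrm_ge0 andbT eq_sym nrm_eq0. Qed.

Lemma nrmD x y : nrm (x + y) <= nrm x + nrm y.
Proof. by rewrite -lecR raddfD /= -!nrmE ler_normD. Qed.

Lemma nrmN x : nrm (- x) = nrm x.
Proof. by rewrite /nrm normrN. Qed.

Lemma nrmB x y : nrm (x - y) <= nrm x + nrm y.
Proof. by rewrite -(nrmN y) nrmD. Qed.

Lemma nrmBC x y : nrm (x - y) = nrm (y - x).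
Proof. by rewrite -nrmN opprB. Qed.

Lemma nrm_trans y x z : nrm (x - z) <= nrm (x - y) + nrm (y - z).
Proof. by have := nrmD (x - y) (y - z); rewrite addrA subrK. Qed.

Lemma nrmBl x y : nrm x - nrm y <= nrm (x - y).
Proof. by rewrite lerBlDr; have := nrmD (x - y) y; rewrite subrK. Qed.

Lemma nrm_le0 x : (forall e : R, 0 < e -> nrm x <= e) -> x = 0.
Proof.
move=> H; apply/eqP; rewrite -nrm_eq0 eq_le nrm_ge0 andbT.
by apply/ler_addgt0Pr => e /H; rewrite add0r.
Qed.

End Norm.

Section NormComplex.
Context {R : realType}.
Implicit Types z w : R[i].

Lemma nrmM z w : nrm (z * w) = nrm z * nrm w.
Proof. by apply: complexI; rewrite -nrmE normrM !nrmE rmorphM. Qed.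

Lemma nrm_real (r : R) : nrm (r%:C) = `|r|.
Proof. by rewrite /nrm normc_def /= expr0n addr0 sqrtr_sqr. Qed.

Lemma nrm1 : nrm (1 : R[i]) = 1.
Proof. by rewrite /nrm normr1. Qed.

Lemma nrmV z : nrm z^-1 = (nrm z)^-1.
Proof. by apply: complexI; rewrite -nrmE normfV nrmE fmorphV. Qed.

Lemma nrm_sqrt z : nrm z = Num.sqrt (complex.Re z ^+ 2 + complex.Im z ^+ 2).
Proof. by rewrite /nrm normc_def. Qed.

Lemma nrm_sqr z : nrm z ^+ 2 = complex.Re z ^+ 2 + complex.Im z ^+ 2.
Proof. by rewrite nrm_sqrt sqr_sqrtr // addr_ge0 // sqr_ge0. Qed.

Lemma Re_le_nrm z : `|complex.Re z| <= nrm z.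
Proof. by rewrite nrm_sqrt -sqrtr_sqr ler_wsqrtr // lerDl sqr_ge0. Qed.

Lemma Im_le_nrm z : `|complex.Im z| <= nrm z.
Proof. by rewrite nrm_sqrt -sqrtr_sqr ler_wsqrtr // lerDr sqr_ge0. Qed.

Lemma nrm_le_ReIm z : nrm z <= `|complex.Re z| + `|complex.Im z|.
Proof.
rewrite -(@ler_pXn2r _ 2) ?nnegrE ?nrm_ge0 ?addr_ge0 // nrm_sqr sqrrD !real_normK ?num_real //.
by rewrite lerD2r lerDl mulrn_wge0 // mulr_ge0.
Qed.

Lemma nrmZ {V : normedModType R[i]} z (x : V) : nrm (z *: x) = nrm z * nrm x.
Proof. by apply: complexI; rewrite -nrmE normrZ !nrmE rmorphM. Qed.

Lemma scaleRK (V : normedModType R[i]) (r : R) (x : V) :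
  r != 0 -> r%:C *: ((r^-1)%:C *: x) = x.
Proof. by move=> r0; rewrite scalerA -rmorphM /= divff // scale1r. Qed.

End NormComplex.

(** * Limits expressed with real tolerances *)

Section Cvg.
Context {R : realType} {V : normedModType R[i]}.

Lemma cvg_nrmP {T : Type} (F : set_system T) (FF : Filter F) (u : T -> V) (y : V) :
  u @ F --> y <-> (forall e : R, 0 < e -> \forall t \near F, nrm (u t - y) < e).
Proof.
split=> [/cvgrPdist_lt h e e0|h].
  have /h : (0 : R[i]) < e%:C by rewrite ltcR.
  by apply: filterS => t; rewrite distrC nrmE ltcR.
apply/cvgrPdist_lt => e e0.
have eE : e = (complex.Re e)%:C by rewrite RRe_real // gtr0_real.
have /h : 0 < complex.Re e by move: e0; rewrite eE ltcR.
by apply: filterS => t H; rewrite distrC nrmE eE ltcR.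
Qed.

Lemma cvg_seqP (u : nat -> V) (y : V) :
  u @ \oo --> y <-> (forall e : R, 0 < e -> exists N, forall n, (N <= n)%N -> nrm (u n - y) < e).
Proof.
rewrite cvg_nrmP; split=> h e /h.
  by case=> N _ H; exists N => n Nn; apply: H.
by case=> N H; exists N => // n Nn; apply: H.
Qed.

Lemma cvg_seq_unique (u : nat -> V) (x y : V) :
  u @ \oo --> x -> u @ \oo --> y -> x = y.
Proof. by move=> ux uy; apply: (cvg_unique _ ux uy). Qed.

Lemma cvg0rightP (u : R -> V) (y : V) :
  u t @[t --> 0^'+] --> y <->
  (forall e : R, 0 < e -> exists2 r : R, 0 < r & forall t, 0 < t -> t < r -> nrm (u t - y) < e).
Proof.
rewrite cvg_nrmP; split=> h e /h.
  case=> r /= r0 H; exists r => // t t0 tr; apply: H => //=.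
  by rewrite sub0r normrN gtr0_norm.
case=> r r0 H; exists r => //= t; rewrite /ball_ /= sub0r normrN => tr t0.
by apply: H => //; rewrite -(gtr0_norm t0).
Qed.

Lemma cvg0punctP (u : R -> V) (y : V) :
  u t @[t --> 0^'] --> y <->
  (forall e : R, 0 < e -> exists2 r : R, 0 < r & forall t, t != 0 -> `|t| < r -> nrm (u t - y) < e).
Proof.
rewrite cvg_nrmP; split=> h e /h.
  case=> r /= r0 H; exists r => // t t0 tr; apply: H => //=.
  by rewrite sub0r normrN.
case=> r r0 H; exists r => //= t; rewrite /ball_ /= sub0r normrN => tr t0.
exact: H.
Qed.

End Cvg.

Lemma cvg_at_nrmP {R : realType} {V W : normedModType R[i]} (f : V -> W) x l :
  f @ x --> l <-> forall e : R, 0 < e -> exists2 d : R, 0 < d &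
    forall y, nrm (y - x) < d -> nrm (f y - l) < e.
Proof.
rewrite cvg_nrmP; split=> h e /h.
  case/nbhs_ballP => d /= d0 H.
  have dE : d = (complex.Re d)%:C by rewrite RRe_real // gtr0_real.
  exists (complex.Re d); first by move: d0; rewrite dE ltcR.
  by move=> y yx; apply: H; rewrite -ball_normE /= nrmE nrmBC dE ltcR.
case=> d d0 H; apply/nbhs_ballP; exists d%:C; first by rewrite /= ltcR.
by move=> y; rewrite -ball_normE /= nrmE nrmBC ltcR => /H.
Qed.

Lemma open_nrmP {R : realType} {V : normedModType R[i]} (U : set V) :
  open U <-> forall x, U x -> exists2 d : R, 0 < d & forall y, nrm (y - x) < d -> U y.
Proof.
rewrite openE; split=> H x /H.
  case/nbhs_ballP => d /= d0 Hd.
  have dE : d = (complex.Re d)%:C by rewrite RRe_real // gtr0_real.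
  exists (complex.Re d); first by move: d0; rewrite dE ltcR.
  by move=> y yx; apply: Hd; rewrite -ball_normE /= nrmE nrmBC dE ltcR.
case=> d d0 Hd; apply/nbhs_ballP; exists d%:C; first by rewrite /= ltcR.
by move=> y; rewrite -ball_normE /= nrmE nrmBC ltcR => /Hd.
Qed.

(** * Completeness, bounded operators, Banach-Steinhaus *)

Section Complete.
Context {R : realType} {X : completeNormedModType R[i]}.

Lemma seq_complete (u : nat -> X) :
  (forall e : R, 0 < e -> exists N, forall n, (N <= n)%N -> nrm (u N - u n) < e) ->
  exists y : X, u @ \oo --> y.
Proof.
move=> h; suff /cvg_ex[l ul] : cvg (u @ \oo) by exists l.
suff : cauchy (u @ \oo) by exact: cauchy_cvg.
suff : cauchy_ex (u @ \oo) by exact: cauchy_exP.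
move=> e e0; rewrite /fmapE -ball_normE /ball_.
have eE : e = (complex.Re e)%:C by rewrite RRe_real // gtr0_real.
have /h [N HN] : 0 < complex.Re e by move: e0; rewrite eE ltcR.
exists (u N), N => // m Nm /=; rewrite nrmE eE ltcR; exact: HN.
Qed.

(** The hypotheses place the closed ball of radius [r n.+1] around [x n.+1] inside the one of radius
    [r n] around [x n], and the radii tend to 0. This takes the place of Baire's theorem in the
    proof of Banach-Steinhaus. *)
Lemma nested_balls (x : nat -> X) (r : nat -> R) :
  (forall n, 0 < r n) -> (forall n, r n.+1 <= r n / 2) ->
  (forall n, nrm (x n.+1 - x n) <= r n / 2) ->
  exists y, forall n, nrm (y - x n) <= r n.
Proof.
move=> r0 rr xx.
have B n k : nrm (x (n + k)%N - x n) <= r n.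
  elim: k n => [|k IH] n; first by rewrite addn0 subrr nrm0 ltW.
  rewrite (le_trans (nrm_trans (x n.+1) _ _)) // addnS -addSn.
  by have := IH n.+1; have := rr n; have := xx n; lra.
have rn n : r n <= r 0%N / (2 ^+ n).
  elim: n => [|n IH]; first by rewrite expr0 divr1.
  rewrite (le_trans (rr n)) // exprSr invfM mulrA ler_pM2r //.
have [y uy] : exists y : X, x @ \oo --> y.
  apply: seq_complete => e e0.
  have [N] : exists N, r N < e.
    have [N HN] : exists N : nat, r 0%N / e < N%:R by exists (Num.bound (r 0%N / e));
      rewrite archi_boundP // divr_ge0 // ltW.
    exists N; rewrite (le_lt_trans (rn N)) // ltr_pdivrMr ?exprn_gt0 // mulrC -ltr_pdivrMr //.
    by rewrite (lt_trans HN) // -natrX ltr_nat ltn_expl.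
  by exists N => n Nn; rewrite nrmBC -(subnKC Nn) (le_lt_trans (B _ _)).
exists y => n; apply/ler_addgt0Pr => e e0.
have [N HN] := (cvg_seqP _ _).1 uy e e0.
have := HN (n + N)%N (leq_addl _ _); have := B n N.
have := nrm_trans (x (n + N)%N) y (x n); rewrite (nrmBC y (x (n + N)%N)); lra.
Qed.

Lemma linop0 (T : X -> X) : linear T -> T 0 = 0.
Proof. by move=> lT; have := lT (-1) 0 0; rewrite scaleN1r oppr0 addr0 scaleN1r addNr. Qed.
Lemma linopZ (T : X -> X) c x : linear T -> T (c *: x) = c *: T x.
Proof. by move=> lT; have := lT c x 0; rewrite (linop0 lT) !addr0. Qed.
Lemma linopD (T : X -> X) x y : linear T -> T (x + y) = T x + T y.
Proof. by move=> lT; have := lT 1 x y; rewrite !scale1r. Qed.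
Lemma linopN (T : X -> X) x : linear T -> T (- x) = - T x.
Proof. by move=> lT; rewrite -scaleN1r linopZ // scaleN1r. Qed.
Lemma linopB (T : X -> X) x y : linear T -> T (x - y) = T x - T y.
Proof. by move=> lT; rewrite linopD // linopN. Qed.

Definition bounded_by (C : R) (T : X -> X) : Prop := forall x, nrm (T x) <= C * nrm x.

Lemma bounded_op_bound (T : X -> X) : bounded_operator T -> exists2 C, 0 < C & bounded_by C T.
Proof.
case=> lT cT.
have T0 := linop0 lT.
have /cvg_at_nrmP/(_ _ ltr01)[r r0 H] := cT 0.
exists (2 / r); first by rewrite divr_gt0.
move=> x; have [->|x0] := eqVneq x 0; first by rewrite T0 nrm0 mulr0.
have nx0 : 0 < nrm x by rewrite nrm_gt0.
(* [T] stays below 1 on the ball of radius [r]; rescaling [x] to norm [r / 2] gives the constant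
   [2 / r]. *)
pose c := r / 2 / nrm x.
have c0 : 0 < c by rewrite /c !divr_gt0.
have := H (c%:C *: x); rewrite subr0 nrmZ nrm_real gtr0_norm //.
rewrite T0 subr0 (linopZ _ _ lT) nrmZ nrm_real gtr0_norm //.
have -> : c * nrm x = r / 2 by rewrite /c divfK // gt_eqF.
move=> /(_ _)/ltW; rewrite -ler_pdivlMl // mulr1 => /(_ _)/le_trans; apply; first by lra.
by rewrite /c !invfM !invrK (mulrC 2).
Qed.

Lemma bounded_by_op C (T : X -> X) : linear T -> bounded_by C T -> bounded_operator T.
Proof.
move=> lT bT; split => //.
move=> x; apply/cvg_at_nrmP => e e0.
pose C' := `|C| + 1.
have C'0 : 0 < C' by rewrite ltr_wpDl.
exists (e / C'); first by rewrite divr_gt0.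
move=> y; rewrite ltr_pdivlMr // => H.
rewrite -(linopB _ _ lT) (le_lt_trans (bT _)) // (le_lt_trans _ H) // mulrC ler_wpM2l ?nrm_ge0 //.
by rewrite /C'; have := ler_norm C; lra.
Qed.

Lemma bounded_op_cvg (T : X -> X) {I} (F : set_system I) {FF : Filter F} (u : I -> X) y :
  bounded_operator T -> u @ F --> y -> T (u i) @[i --> F] --> T y.
Proof. by case=> _ cT uy; exact: (cvg_comp _ _ uy (cT y)). Qed.

(* Banach-Steinhaus: if the bound fails, balls are shrunk around points where
   larger and larger values are taken, contradicting boundedness at the limit. *)
Lemma uniform_boundedness (I : Type) (F : I -> X -> X) :
  (forall i, bounded_operator (F i)) ->
  (forall x, exists C, forall i, nrm (F i x) <= C) ->
  exists2 C, 0 < C & forall i, bounded_by C (F i).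
Proof.
move=> bF pF; apply: contrapT => nC.
(* The premise [0 < p.2] sits under the existential so that [choice] applies to every pair; the
   recursion keeps it true. *)
have step (n : nat) (p : X * R) : exists q : X * R, 0 < p.2 ->
    [/\ 0 < q.2, q.2 <= p.2 / 2, nrm (q.1 - p.1) <= p.2 / 2 &
      exists i, forall z, nrm (z - q.1) <= q.2 -> n%:R <= nrm (F i z)].
  case: p => x r /=; have [r0|] := ltP 0 r; last by exists (x, r).
  have r2 : 0 < r / 2 by rewrite divr_gt0.
  have [i [z zn]] : exists i z, (2 * n.+1%:R / r) * nrm z < nrm (F i z).
    apply: contrapT => H; apply: nC; exists (2 * n.+1%:R / r); first
      by rewrite divr_gt0 // mulr_gt0.
    by move=> i z; rewrite leNgt; apply/negP => Hz; apply: H; exists i, z.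
  have lF := (bF i).1.
  have z0 : z != 0 by apply: contraTneq zn => ->; rewrite (linop0 lF) nrm0 mulr0 ltxx.
  have nz : 0 < nrm z by rewrite nrm_gt0.
  have [w wr wn] : exists2 w, nrm w <= r / 2 & n.+1%:R <= nrm (F i w).
    have c0 : 0 < r / 2 / nrm z by rewrite !divr_gt0.
    exists ((r / 2 / nrm z)%:C *: z).
      by rewrite nrmZ nrm_real gtr0_norm // divfK // gt_eqF.
    rewrite (linopZ _ _ lF) nrmZ nrm_real gtr0_norm //.
    move: zn => /ltW; rewrite -(ler_pM2l c0); apply: le_trans.
    by rewrite le_eqVlt; apply/orP; left; apply/eqP; field; rewrite !gt_eqF.
  (* The images of [x + w] and [x - w] differ by twice [F i w], so one of them is at least as large
     as [F i w]. *)
  have [y yr yn] : exists2 y, nrm (y - x) <= r / 2 & n.+1%:R <= nrm (F i y).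
    have [H|H] := leP n.+1%:R (nrm (F i (x + w))).
      by exists (x + w) => //; rewrite addrAC subrr add0r.
    exists (x - w); first by rewrite addrAC subrr add0r nrmN.
    rewrite leNgt; apply/negP => H'.
    have := nrmB (F i (x + w)) (F i (x - w)).
    rewrite -(linopB _ _ lF) opprB addrC -addrA (addrA (- x))
      addNr add0r -mulr2n -scaler_nat (linopZ _ _ lF) nrmZ.
    rewrite -(rmorph_nat (real_complex R)) nrm_real ger0_norm //; move: H H' wn; lra.
  have [C C0 CF] := bounded_op_bound (bF i).
  (* Within distance [C^-1] the map [F i] changes by at most 1, so the bound [n.+1] at the centre
     leaves [n] on the whole ball. *)
  exists (y, Num.min (r / 2) C^-1) => /= _; split => //.
  - by rewrite lt_min r2 invr_gt0.
  - by rewrite ge_min lexx.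
  exists i => u; rewrite le_min => /andP[_ uy].
  have := nrmBl (F i y) (F i u); rewrite -(linopB _ _ lF) => H1.
  have := CF (y - u); rewrite nrmBC => H2.
  have H3 : C * nrm (u - y) <= 1 by rewrite mulrC -ler_pdivlMr // mul1r.
  by move: yn; rewrite -natr1; lra.
have [f Hf] := choice (fun np : nat * (X * R) => step np.1 np.2).
pose fix s n := if n is p.+1 then f (p, s p) else (0, 1) : X * R.
have s0 n : 0 < (s n).2 by elim: n => //= n IH; case: (Hf (n, s n) IH).
have [y Hy] : exists y, forall n, nrm (y - (s n).1) <= (s n).2.
  by apply: nested_balls => // n; case: (Hf (n, s n) (s0 n)).
have [C HC] := pF y.
pose n := Num.bound `|C|.
have [_ _ _ [i Hi]] := Hf (n, s n) (s0 n).
have := Hi y (Hy n.+1); have := HC i; have := archi_boundP (normr_ge0 C).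
have := ler_norm C; rewrite -/n /=; lra.
Qed.

End Complete.

(** * The complex exponential *)

Section ComplexExponential.
Context {R : realType}.
Implicit Types (x y : R) (z w : R[i]).

Definition cexp z : R[i] :=
  (expR (complex.Re z) * cos (complex.Im z)) +i* (expR (complex.Re z) * sin (complex.Im z)).

Lemma cexp0 : cexp 0 = 1.
Proof. by rewrite /cexp /= expR0 cos0 sin0 mulr0 mulr1. Qed.

Lemma cexpD z w : cexp (z + w) = cexp z * cexp w.
Proof.
case: z => a b; case: w => c d; apply/eqP; rewrite eq_complex /cexp /= expRD cosD sinD.
by apply/andP; split; apply/eqP; ring.
Qed.

Lemma nrm_cexp z : nrm (cexp z) = expR (complex.Re z).
Proof.
by rewrite nrm_sqrt /= !exprMn -mulrDr cos2Dsin2 mulr1 sqrtr_sqr ger0_norm.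
Qed.

(** From [1 + x <= e^x], used at [x] and at [- x], follows [x <= e^x - 1 <= x e^x]; the factor
    [1 + expR x] serves both signs of [x]. *)
Lemma expR_sub1_le x : `|expR x - 1| <= `|x| * (1 + expR x).
Proof.
have h1 := expR_ge1Dx x; have h2 := expR_ge1Dx (- x).
have e0 := expR_gt0 x.
have h3 : expR x * (1 - x) <= 1.
  by rewrite -[leRHS](expRxMexpNx_1 x) ler_pM2l.
have := ler_norm x; have := ler_norm (- x); rewrite normrN => h4 h5.
rewrite ler_norml; apply/andP; split; nra.
Qed.

(** Here [0 <= e^x - 1 - x <= x (e^x - 1)], again from [e^x (1 - x) <= 1], and [expR_sub1_le] bounds
    the last factor. *)
Lemma expR_sub1x_le x : `|expR x - 1 - x| <= x ^+ 2 * (1 + expR x).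
Proof.
have h1 := expR_ge1Dx x; have h2 := expR_ge1Dx (- x).
have e0 := expR_gt0 x.
have h3 : expR x * (1 - x) <= 1 by rewrite -[leRHS](expRxMexpNx_1 x) ler_pM2l.
have h4 := expR_sub1_le x.
rewrite ger0_norm; last by lra.
apply: (@le_trans _ _ (x * (expR x - 1))); first by lra.
rewrite (le_trans (ler_norm _)) // normrM -(real_normK (num_real x)) expr2 -mulrA.
by rewrite ler_wpM2l.
Qed.

Lemma sin_le_abs y : `|sin y| <= `|y|.
Proof.
wlog y0 : y / 0 <= y => [H|].
  have [/H//|/ltW y0] := leP 0 y.
  by rewrite -(normrN (sin y)) -sinN -(normrN y); apply: H; rewrite oppr_ge0.
have D t (_ : t \in `]0, y[) : is_derive t 1 sin (cos t) := is_derive_sin t.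
have C : {within `[0, y], continuous sin}.
  by apply/continuous_subspaceT => t; exact: continuous_sin.
have [c _] := MVT_segment y0 D C.
rewrite sin0 !subr0 => ->; rewrite normrM.
by rewrite ler_piMl // cos_max.
Qed.

Lemma one_sub_cos y : 1 - cos y = 2 * sin (y / 2) ^+ 2.
Proof.
have -> : y = (y / 2) *+ 2 by rewrite -mulr_natr divfK.
rewrite cos_mulr2n cos2sin2; have -> : ((y / 2) *+ 2) / 2 = y / 2 by rewrite -mulr_natr mulfK.
by ring.
Qed.

Lemma one_sub_cos_le_abs y : 1 - cos y <= `|y|.
Proof.
rewrite one_sub_cos -(real_normK (num_real (sin _))).
have := sin_max (y / 2); have := sin_le_abs (y / 2).
rewrite normrM (ger0_norm (_ : 0 <= 2^-1)) ?invr_ge0 //.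
have := normr_ge0 (sin (y / 2)); nra.
Qed.

Lemma one_sub_cos_le y : 1 - cos y <= y ^+ 2.
Proof.
rewrite one_sub_cos -(real_normK (num_real (sin _))) -(real_normK (num_real y)).
have := sin_le_abs (y / 2).
rewrite normrM (ger0_norm (_ : 0 <= 2^-1)) ?invr_ge0 //.
have := normr_ge0 (sin (y / 2)); have := normr_ge0 y; nra.
Qed.

Lemma sin_sub_le y : `|sin y - y| <= y ^+ 2.
Proof.
wlog y0 : y / 0 <= y => [H|].
  have [/H//|/ltW y0] := leP 0 y.
  have -> : sin y - y = - (sin (- y) - (- y)) by rewrite sinN; ring.
  by rewrite normrN -sqrrN; apply: H; rewrite oppr_ge0.
have D t (_ : t \in `]0, y[) : is_derive t 1 (fun t => sin t - t) (cos t - 1).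
  exact: is_deriveB.
have C : {within `[0, y], continuous (fun t => sin t - t)}.
  apply/continuous_subspaceT => t; apply: cvgB; first exact: continuous_sin.
  exact: cvg_id.
have [c] := MVT_segment y0 D C.
rewrite in_itv /= sin0 !subr0 => /andP[c0 cy] ->; rewrite normrM.
rewrite distrC (ger0_norm (_ : 0 <= 1 - cos c)) ?subr_ge0 ?cos_le1 //.
rewrite ger0_norm // expr2 ler_wpM2r //.
by rewrite (le_trans (one_sub_cos_le_abs c)) // ger0_norm.
Qed.

(** The growth factor depends on [Re z] alone. The factor [e^|z|] that the power series would give
    is of no use on an unbounded spectrum, of which only the real parts are bounded above. *)
Lemma cexp_sub1z_le z :
  nrm (cexp z - 1 - z) <= 4 * nrm z ^+ 2 * (1 + expR (complex.Re z)).
Proof.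
rewrite nrm_sqr; case: z => x y /=.
rewrite (le_trans (nrm_le_ReIm _)) //= subr0.
have -> : expR x * cos y - 1 - x = (expR x - 1 - x) - expR x * (1 - cos y) by ring.
have -> : expR x * sin y - y = (expR x - 1) * sin y + (sin y - y) by ring.
have h1 := expR_sub1x_le x; have h2 := one_sub_cos_le y; have h3 := sin_sub_le y.
have h4 := expR_sub1_le x; have h5 := sin_le_abs y.
have e0 := expR_gt0 x.
have h6 := ler_normB (expR x - 1 - x) (expR x * (1 - cos y)).
have h7 := ler_normD ((expR x - 1) * sin y) (sin y - y).
rewrite normrM in h7; rewrite normrM (gtr0_norm e0) (ger0_norm (_ : 0 <= 1 - cos y)) in h6;
  last by rewrite subr_ge0 cos_le1.
have h8 : `|expR x - 1| * `|sin y| <= `|x| * (1 + expR x) * `|y| by apply: ler_pM.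
have h9 : `|x| * `|y| <= x ^+ 2 + y ^+ 2.
  rewrite -(real_normK (num_real x)) -(real_normK (num_real y)); have := sqr_ge0 (`|x| - `|y|).
  by have := sqr_ge0 (`|x|); have := sqr_ge0 `|y|; nra.
have := sqr_ge0 x; have := sqr_ge0 y.
have h10 : `|x| * (1 + expR x) * `|y| <= (x ^+ 2 + y ^+ 2) * (1 + expR x).
  by rewrite mulrAC ler_wpM2r // addr_ge0 // ltW.
have h11 : expR x * (1 - cos y) <= expR x * y ^+ 2 by rewrite ler_pM2l.
nra.
Qed.

Lemma cexp_sub1_le z :
  nrm (cexp z - 1) <= nrm z * (1 + 4 * nrm z * (1 + expR (complex.Re z))).
Proof.
have := cexp_sub1z_le z; have := nrmD (cexp z - 1 - z) z; rewrite subrK; lra.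
Qed.

Lemma cexp_continuous : continuous (cexp : R[i]^o -> R[i]^o).
Proof.
move=> z; apply/(@cvg_at_nrmP _ R[i]^o R[i]^o) => e e0.
(* This is [cexp_sub1_le] at [w - z], whose norm and real part are at most 1, times the modulus of
   [cexp z]. *)
pose C := expR (complex.Re z) * (1 + 4 * (1 + expR 1)).
have C0 : 0 < C by rewrite mulr_gt0 ?expR_gt0 //; have := expR_gt0 (1 : R); lra.
exists (Num.min 1 (e / C)); first by rewrite lt_min ltr01 divr_gt0.
move=> w; rewrite lt_min ltr_pdivlMr // => /andP[w1 we].
have -> : cexp w - cexp z = (cexp (w - z) - 1) * cexp z.
  by rewrite mulrBl mul1r -cexpD subrK.
rewrite nrmM nrm_cexp.
rewrite (le_lt_trans _ we) // mulrC /C mulrCA ler_pM2l ?expR_gt0 //.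
rewrite (le_trans (cexp_sub1_le _)) // ler_wpM2l ?nrm_ge0 //.
have h1 : expR (complex.Re (w - z)) <= expR 1.
  by rewrite ler_expR (le_trans (ler_norm _)) // (le_trans (Re_le_nrm _)) // ltW.
have := expR_gt0 (complex.Re (w - z)); have := nrm_ge0 (w - z); nra.
Qed.

End ComplexExponential.

(** * Spectral measures *)

Section Borel.
Context {R : realType}.
Implicit Types d : set R[i].

Lemma borel_open (U : set R[i]^o) : open U -> borel (U : set R[i]).
Proof. by move=> oU; exact: sub_sigma_algebra. Qed.

Lemma borel0 : borel (set0 : set R[i]).
Proof. exact: sigma_algebra0. Qed.

Lemma borelC d : borel d -> borel (~` d).
Proof. exact: sigma_algebraC. Qed.

Lemma borelT : borel ([set: R[i]]).
Proof. by rewrite -setC0; apply: borelC; exact: borel0. Qed.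

Lemma borel_bigcup (d : nat -> set R[i]) : (forall n, borel (d n)) -> borel (\bigcup_n d n).
Proof. exact: sigma_algebra_bigcup. Qed.

Lemma borelU d d' : borel d -> borel d' -> borel (d `|` d').
Proof.
move=> bd bd'; rewrite -bigcup2E; apply: borel_bigcup => -[|[|n]] //=.
exact: borel0.
Qed.

Lemma borelI d d' : borel d -> borel d' -> borel (d `&` d').
Proof. by move=> bd bd'; rewrite -(setCK (d `&` d')) setCI; apply: borelC; apply: borelU;
  exact: borelC. Qed.

Lemma borelD d d' : borel d -> borel d' -> borel (d `\` d').
Proof. by move=> bd bd'; rewrite setDE; apply: borelI => //; exact: borelC. Qed.

End Borel.
Arguments borel0 {R}.
Arguments borelT {R}.

Section SpectralMeasure.
Context {R : realType} {X : completeNormedModType R[i]}.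
Variable E : set R[i] -> X -> X.
Hypothesis hE : spectral_measure E.
Implicit Types (d D : set R[i]) (f x y : X).

Lemma E_bounded d : borel d -> bounded_operator (E d).
Proof. by case: hE => h _ _ _ _; exact: h. Qed.

Lemma E_linear d : borel d -> linear (E d).
Proof. by case/E_bounded. Qed.

Lemma E_set0 f : E set0 f = 0.
Proof. by case: hE => _ h _ _ _; exact: h. Qed.

Lemma E_setT f : E [set: R[i]] f = f.
Proof. by case: hE => _ _ h _ _; exact: h. Qed.

Lemma E_setI d d' f : borel d -> borel d' -> E (d `&` d') f = E d (E d' f).
Proof. by case: hE => _ _ _ h _ ? ?; exact: h. Qed.

Lemma E_bigcup (d : nat -> set R[i]) f : (forall n, borel (d n)) -> trivIset [set: nat] d ->
  series (fun n => E (d n) f) @ \oo --> E (\bigcup_n d n) f.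
Proof. by case: hE => _ _ _ _ h ? ?; exact: h. Qed.

Lemma E_setU d d' f : borel d -> borel d' -> d `&` d' = set0 ->
  E (d `|` d') f = E d f + E d' f.
Proof.
move=> bd bd' dd; rewrite -bigcup2E.
have bb n : borel (bigcup2 d d' n) by case: n => [|[|n]] //=; exact: borel0.
have tt : trivIset [set: nat] (bigcup2 d d').
  apply/trivIsetP => -[|[|i]] [|[|j]] //= _ _ _; rewrite ?set0I ?setI0 //.
  by rewrite setIC.
apply: (cvg_seq_unique (@E_bigcup _ f bb tt)).
apply/cvg_seqP => e e0; exists 2%N => -[|[|n]] // _.
rewrite /series /= big_nat_recl // big_nat_recl //= big1 ?addr0 ?addrK ?subrr ?nrm0 //.
by move=> i _; rewrite E_set0.
Qed.

Lemma E_setIC d D f : borel d -> borel D -> E D f = E (D `&` d) f + E (D `\` d) f.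
Proof.
move=> bd bD; rewrite -E_setU ?setUIDK //.
- exact: borelI.
- exact: borelD.
by rewrite setDE setIACA setICr setI0.
Qed.

Lemma E_nondecreasing (B : nat -> set R[i]) f : (forall n, borel (B n)) ->
  nondecreasing_seq B -> E (B n) f @[n --> \oo] --> E (\bigcup_n B n) f.
Proof.
move=> bB ndB.
have bs n : borel (seqD B n) by case: n => //= n; exact: borelD.
have := @E_bigcup _ f bs (trivIset_seqD ndB); rewrite eq_bigcup_seqD => /cvg_seqP h.
(* The shift by one: the partial sum of index [n.+1] has the terms 0 to [n], and these successive
   differences fill [B n]. *)
apply/cvg_seqP => e /h [N HN]; exists N => n Nn; have := HN n.+1 (leqW Nn).
suff -> : series (fun n => E (seqD B n) f) n.+1 = E (B n) f by [].
rewrite /series /=; elim: n {Nn} => [|n IH]; first by rewrite big_nat1.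
rewrite big_nat_recr //= IH (E_setIC f (bB n) (bB n.+1)) setIC; congr (E _ _ + _).
by apply/esym/setIidPl; move/subsetPset: (ndB _ _ (leqnSn n)).
Qed.

(* If the values on subsets of [D] are unbounded, they stay so on a part [D']
   of [D] whose complement in [D] has a large value; iterating contradicts the
   convergence of a series of values on disjoint sets. *)
Lemma E_range_bounded f : exists C, forall d, borel d -> nrm (E d f) <= C.
Proof.
pose ub D := exists C, forall d, borel d -> nrm (E (d `&` D) f) <= C.
suff : ub setT by case=> C HC; exists C => d bd; have := HC d bd; rewrite setIT.
apply: contrapT => nub.
have step (n : nat) (D : {D | borel D /\ ~ ub D}) : exists D' : {D | borel D /\ ~ ub D},
   sval D' `<=` sval D /\ n%:R <= nrm (E (sval D `\` sval D') f).
  case: D => D [bD nD] /=.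
  (* The extra [nrm (E D f)] makes the values on both [D]&[d] and [D]\[d] at least [n], by
     additivity. So whichever half stays unbounded can be kept, and the discarded one is large. *)
  have [d [bd dn]] : exists d, borel d /\ n%:R + nrm (E D f) < nrm (E (d `&` D) f).
    apply: contrapT => H; apply: nD; exists (n%:R + nrm (E D f)) => d bd.
    by rewrite leNgt; apply/negP => H'; apply: H; exists d.
  have b1 := borelI bD bd; have b2 := borelD bD bd.
  have e1 := E_setIC f bd bD; rewrite (setIC d) in dn.
  have dn2 : n%:R <= nrm (E (D `\` d) f).
    have := nrmBl (E (D `&` d) f) (E D f); rewrite {2}e1 opprD addNKr nrmN; lra.
  have [u1|u1] := pselect (ub (D `&` d)); last first.
    exists (exist _ (D `&` d) (conj b1 u1)) => /=; split; first exact: subIsetl.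
    by rewrite setDIr setDv set0U.
  have u2 : ~ ub (D `\` d).
    move=> u2; apply: nD; case: u1 => C1 H1; case: u2 => C2 H2; exists (C1 + C2) => c bc.
    have -> : c `&` D = (c `&` (D `&` d)) `|` (c `&` (D `\` d)) by rewrite -setIUr setUIDK.
    rewrite E_setU ?(le_trans (nrmD _ _)) ?lerD ?H1 ?H2 //; [exact: borelI|exact: borelI|].
    by apply/seteqP; split=> z //= [[_ [_ dz]] [_ [_ /(_ dz)]]].
  exists (exist _ (D `\` d) (conj b2 u2)) => /=; split; first exact: subDsetl.
  by rewrite setDD; have := nrm_ge0 (E D f); lra.
have [g Hg] := choice (fun nD : nat * {D | borel D /\ ~ ub D} => step nD.1 nD.2).
pose fix s n := if n is p.+1 then g (p, s p) else exist _ setT (conj borelT nub)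
  : {D | borel D /\ ~ ub D}.
pose d n := sval (s n) `\` sval (s n.+1).
have bd n : borel (d n) by apply: borelD; [case: (svalP (s n))|case: (svalP (s n.+1))].
have sub n k : sval (s (n + k)%N) `<=` sval (s n).
  elim: k => [|k IH]; first by rewrite addn0.
  by rewrite addnS; apply: subset_trans IH; case: (Hg ((n + k)%N, s (n + k)%N)).
have td : trivIset [set: nat] d.
  apply/trivIsetP => i j _ _.
  wlog ij : i j / (i < j)%N => [H|_].
    by rewrite neq_ltn => /orP[ij|ij]; [|rewrite setIC]; apply: H => //; rewrite neq_ltn ij.
  rewrite -subset0 => z [[_ nz] [z' _]]; apply: nz.
  by apply: (sub i.+1 (j - i.+1)%N); rewrite subnKC.
have /cvg_seqP/(_ _ ltr01) [N HN] := @E_bigcup _ f bd td.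
(* The partial sums of index [n] and [n.+1] are both within 1 of the limit, so the term of index [n]
   has norm below 2, while by construction it is at least [n], hence at least 2. *)
pose n := N.+2.
have h1 := HN n (leqW (leqnSn N)); have h2 := HN n.+1 (leqW (leqW (leqnSn N))).
move: h2; rewrite /series /= big_nat_recr //= => h2.
have [_] := Hg (n, s n) => /=; rewrite -/(d n) => h3.
have : (2 : R) <= n%:R by rewrite ler_nat.
move: h1 h2; rewrite /series /=; set S := \sum_(_ <= _ < _) _; set L := E (\bigcup_n d n)
  f => h1 h2.
have := nrmB (S + E (d n) f - L) (S - L).
rewrite opprB addrA subrK addrAC subrr add0r; move: h3 h1 h2.
lra.
Qed.

Lemma E_uniformly_bounded : exists2 M, 0 < M & forall d, borel d -> bounded_by M (E d).
Proof.
have [||M M0 HM] := @uniform_boundedness R X {d : set R[i] | borel d} (fun p => E (sval p)).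
- by case=> d bd; exact: E_bounded.
- by move=> f; have [C HC] := E_range_bounded f; exists C => -[d bd]; exact: HC.
by exists M => // d bd; exact: (HM (exist _ d bd)).
Qed.

End SpectralMeasure.

(** * Functional calculus for bounded functions *)

Section FunctionalCalculus.
Context {R : realType} {X : completeNormedModType R[i]}.
Implicit Types (d D : set R[i]) (s : seq (R[i] * set R[i])) (F G : R[i] -> R[i]).

Definition borels s := forall p, p \in s -> borel p.2.

Lemma borels_cons p s : borels (p :: s) <-> borel p.2 /\ borels s.
Proof.
split=> [h|[h1 h2] q]; last by rewrite in_cons => /orP[/eqP ->|/h2].
by split=> [|q qs]; apply: h; rewrite in_cons ?eqxx ?qs ?orbT.
Qed.

Lemma borels_cat s s' : borels s -> borels s' -> borels (s ++ s').
Proof. by move=> h h' p; rewrite mem_cat => /orP[/h|/h']. Qed.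

Definition scales (c : R[i]) s := [seq (c * p.1, p.2) | p <- s].
Definition muls s s' := [seq (p.1 * q.1, p.2 `&` q.2) | p <- s, q <- s'].

Lemma borels_scales c s : borels s -> borels (scales c s).
Proof. by move=> h _ /mapP[p /h ? ->]. Qed.

Lemma borels_muls s s' : borels s -> borels s' -> borels (muls s s').
Proof. by move=> h h' _ /allpairsP[[p q] /= [/h ? /h' ? ->]]; exact: borelI. Qed.

Lemma indic_in (A : set R[i]) z : A z -> \1_A z = 1 :> R[i].
Proof. by move=> Az; rewrite indicE mem_set. Qed.

Lemma simple_fun_nil z : simple_fun [::] z = 0 :> R[i].
Proof. by rewrite /simple_fun big_nil. Qed.

Lemma simple_fun_cat s s' z : simple_fun (s ++ s') z = simple_fun s z + simple_fun s' z.
Proof. by rewrite /simple_fun big_cat. Qed.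

Lemma simple_fun_scales c s z : simple_fun (scales c s) z = c * simple_fun s z.
Proof. by rewrite /simple_fun big_map mulr_sumr; under eq_bigr do rewrite /= -mulrA. Qed.

Lemma simple_fun_muls s s' z : simple_fun (muls s s') z = simple_fun s z * simple_fun s' z.
Proof.
rewrite /simple_fun big_allpairs_dep /= mulr_suml; apply: eq_bigr => p _.
rewrite mulr_sumr; apply: eq_bigr => q _ /=.
by rewrite indicI /= mulrACA.
Qed.

Lemma simple_fun_bounded s : exists2 C : R, 0 <= C & forall z, nrm (simple_fun s z) <= C.
Proof.
elim: s => [|p s [C C0 HC]]; first by exists 0 => // z; rewrite simple_fun_nil nrm0.
exists (nrm p.1 + C) => [|z]; first by rewrite addr_ge0 // nrm_ge0.
rewrite /simple_fun big_cons (le_trans (nrmD _ _)) // lerD //; last exact: HC.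
rewrite nrmM ler_piMr ?nrm_ge0 // indicE.
by case: (_ \in _); rewrite ?nrm0 ?nrm1.
Qed.

(* These are exactly the bounded Borel functions. *)
Definition simple_limit F := forall e : R, 0 < e ->
  exists2 s, borels s & forall z, nrm (F z - simple_fun s z) <= e.

Lemma simple_limit_bounded F : simple_limit F ->
  exists2 C : R, 0 < C & forall z, nrm (F z) <= C.
Proof.
move=> /(_ 1 ltr01) [s _ Hs]; have [C C0 HC] := simple_fun_bounded s.
exists (1 + C) => [|z]; first by rewrite ltr_wpDr.
have := nrmBl (F z) (simple_fun s z); have := Hs z; have := HC z; lra.
Qed.

Lemma simple_limit_indic d : borel d -> simple_limit (\1_d : R[i] -> R[i]).
Proof.
move=> bd e e0; exists [:: (1, d)]; first by move=> p; rewrite inE => /eqP ->.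
by move=> z; rewrite /simple_fun big_seq1 mul1r subrr nrm0 ltW.
Qed.

Lemma simple_limit_cst c : simple_limit (fun=> c).
Proof.
move=> e e0; exists [:: (c, setT)]; first by move=> p; rewrite inE => /eqP -> /=; exact: borelT.
by move=> z; rewrite /simple_fun big_seq1 indicT mulr1 subrr nrm0 ltW.
Qed.

Lemma simple_limitD F G : simple_limit F -> simple_limit G ->
  simple_limit (fun z => F z + G z).
Proof.
move=> hF hG e e0; have e2 : 0 < e / 2 by rewrite divr_gt0.
have [s bs Hs] := hF _ e2; have [s' bs' Hs'] := hG _ e2.
exists (s ++ s'); first exact: borels_cat.
move=> z; rewrite simple_fun_cat opprD addrACA.
by have := nrmD (F z - simple_fun s z) (G z - simple_fun s' z); have := Hs z; have := Hs' z; lra.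
Qed.

Lemma simple_limitM F G : simple_limit F -> simple_limit G ->
  simple_limit (fun z => F z * G z).
Proof.
move=> hF hG e e0.
have [C C0 HC] := simple_limit_bounded hF.
(* The approximation of [G] is fixed first: the accuracy required for [F] depends on its bound
   [C']. *)
have [s' bs' Hs'] := hG _ (divr_gt0 (divr_gt0 e0 (ltr0Sn _ 1)) C0).
have [C' C'0 HC'] := simple_fun_bounded s'.
have C'1 : 0 < C' + 1 by lra.
have [s bs Hs] := hF _ (divr_gt0 (divr_gt0 e0 (ltr0Sn _ 1)) C'1).
exists (muls s s'); first exact: borels_muls.
move=> z; rewrite simple_fun_muls.
have -> : F z * G z - simple_fun s z * simple_fun s' z =
  F z * (G z - simple_fun s' z) + (F z - simple_fun s z) * simple_fun s' z by ring.
rewrite (le_trans (nrmD _ _)) // !nrmM.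
have h1 : nrm (F z) * nrm (G z - simple_fun s' z) <= e / 2.
  rewrite -[leRHS](divfK (lt0r_neq0 C0)) // mulrC.
  by rewrite ler_pM ?nrm_ge0.
have h2 : nrm (F z - simple_fun s z) * nrm (simple_fun s' z) <= e / 2.
  rewrite -[leRHS](divfK (lt0r_neq0 C'1)) // ler_pM ?nrm_ge0 //.
  by have := HC' z; lra.
lra.
Qed.

Variable E : set R[i] -> X -> X.
Hypothesis hE : spectral_measure E.
Implicit Types f x y : X.

Definition SI s f := simple_integral E setT s f.

Lemma SI_nil f : SI [::] f = 0.
Proof. by rewrite /SI /simple_integral big_nil. Qed.

Lemma SI_cat s s' f : SI (s ++ s') f = SI s f + SI s' f.
Proof. by rewrite /SI /simple_integral big_cat. Qed.

Lemma SI_scales c s f : SI (scales c s) f = c *: SI s f.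
Proof.
rewrite /SI /simple_integral big_map scaler_sumr.
by apply: eq_bigr => p _ /=; rewrite scalerA.
Qed.

Lemma SI_linear s : borels s -> linear (SI s).
Proof.
move=> bs c x y; rewrite /SI /simple_integral scaler_sumr -big_split /=.
apply: eq_big_seq => p /bs bp; rewrite setIT (E_linear hE bp) scalerDr !scalerA.
by rewrite mulrC.
Qed.

Lemma SI_muls s s' f : borels s -> borels s' -> SI (muls s s') f = SI s (SI s' f).
Proof.
move=> bs bs'; rewrite /SI /simple_integral big_allpairs_dep /=.
apply: eq_big_seq => p /bs bp; rewrite setIT.
have : borels s' by [].
elim: (s') => [_|q t IH /borels_cons[bq bt]].
  by rewrite !big_nil (linop0 (E_linear hE bp)) scaler0.
rewrite !big_cons IH // !setIT (linopD _ _ (E_linear hE bp)) scalerDr (E_setI hE) //.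
by rewrite (linopZ _ _ (E_linear hE bp)) scalerA.
Qed.

(* [x] lies in the closed convex hull of the vectors [c E(d) f], [d `<=` D], as
   far as norms of translates can tell. *)
Definition hull (D : set R[i]) (c : R) f x := forall y (r : R),
  (forall d, borel d -> d `<=` D -> nrm (c%:C *: E d f + y) <= r) -> nrm (x + y) <= r.

(** A convex combination of two generators: [c E(D) f] with weight [v / c], and 0, which comes from
    the empty set, with weight [1 - v / c]. *)
Lemma hull_piece D c f (v : R) : borel D -> 0 <= v <= c -> hull D c f (v%:C *: E D f).
Proof.
move=> bD /andP[v0 vc] y r H.
have h1 := H D bD (@subset_refl _ D).
have h0 := H set0 borel0 (@sub0set _ D).
rewrite (E_set0 hE) scaler0 add0r in h0.
have [c0|c0] := leP c 0.
  have -> : v = 0 by apply/eqP; rewrite eq_le v0 andbT (le_trans vc).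
  by rewrite scale0r add0r.
have t0 : 0 <= v / c by rewrite divr_ge0 // ltW.
have t1 : 0 <= 1 - v / c by rewrite subr_ge0 ler_pdivrMr // mul1r.
have -> : v%:C *: E D f + y = (v / c)%:C *: (c%:C *: E D f + y) + (1 - v / c)%:C *: y.
  rewrite scalerDr scalerA -rmorphM /= divfK ?gt_eqF // -addrA -scalerDl -rmorphD /=.
  by rewrite (addrC (v / c)) subrK scale1r.
rewrite (le_trans (nrmD _ _)) // !nrmZ !nrm_real !ger0_norm //; nra.
Qed.

(** Generators over disjoint sets add up to generators over the union. The translate [y] in [hull]
    lets the two hypotheses be used in turn, each absorbing the other summand into [y]. *)
Lemma hullU D1 D2 c f x1 x2 : borel D1 -> borel D2 -> D1 `&` D2 = set0 ->
  hull D1 c f x1 -> hull D2 c f x2 -> hull (D1 `|` D2) c f (x1 + x2).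
Proof.
move=> b1 b2 dd h1 h2 y r H; rewrite -addrA; apply: h1 => d1 bd1 s1.
rewrite addrCA; apply: h2 => d2 bd2 s2.
rewrite addrCA addrA -scalerDr -(E_setU hE) //.
- by apply: H; [exact: borelU|exact: setUSS].
- by apply/seteqP; split=> z // [/s1 z1 /s2 z2]; rewrite -dd.
Qed.

Definition rvalue (t : seq (R * set R[i])) z : R := \sum_(p <- t) p.1 * \1_(p.2) z.
Definition rintegral (D : set R[i]) (t : seq (R * set R[i])) f : X :=
  \sum_(p <- t) p.1%:C *: E (p.2 `&` D) f.

Lemma rintegral_split (t : seq (R * set R[i])) D d f : borel d -> borel D ->
  (forall p, p \in t -> borel p.2) ->
  rintegral D t f = rintegral (D `&` d) t f + rintegral (D `\` d) t f.
Proof.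
move=> bd bD bt; rewrite -big_split; apply: eq_big_seq => p /bt bp /=.
by rewrite -scalerDr (E_setIC hE f bd (borelI bp bD)) setIA setIDA.
Qed.

(** The sets of [t] may overlap, so the induction cuts [D] along the first of them: its coefficient
    joins the constant [a] on the inner part and vanishes on the outer one. No list of disjoint sets
    has to be built. *)
Lemma hull_rintegral c f (t : seq (R * set R[i])) : (forall p, p \in t -> borel p.2) ->
  forall D (a : R), borel D -> (forall z, D z -> 0 <= a + rvalue t z <= c) ->
  hull D c f (a%:C *: E D f + rintegral D t f).
Proof.
elim: t => [|[v d] t IH] bt D a bD H.
  rewrite /rintegral big_nil addr0.
  have [D0|/set0P[z /H]] := eqVneq D set0; last first.
    by rewrite /rvalue big_nil addr0 => ?; exact: hull_piece.
  move=> y r /(_ set0 borel0 (@sub0set _ _)).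
  by rewrite D0 (E_set0 hE) !scaler0.
have bd : borel d by apply: (bt (v, d)); rewrite in_cons eqxx.
have bt' p : p \in t -> borel p.2 by move=> pt; apply: bt; rewrite in_cons pt orbT.
have -> : a%:C *: E D f + rintegral D ((v, d) :: t) f =
  ((a + v)%:C *: E (D `&` d) f + rintegral (D `&` d) t f) +
  (a%:C *: E (D `\` d) f + rintegral (D `\` d) t f).
  rewrite {1}/rintegral big_cons -/(rintegral D t f) (rintegral_split f bd bD) //=.
  rewrite (E_setIC hE f bd bD) scalerDr rmorphD scalerDl (setIC d) /=.
  by rewrite !addrA [LHS](ACl (1*3*4*2*5)).
rewrite -[X in hull X](setUIDK D d).
apply: hullU; [exact: borelI|exact: borelD| | |].
- by apply/seteqP; split=> z //= [[_ dz] [_ /(_ dz)]].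
- apply: IH => //; first exact: borelI.
  move=> z [Dz dz]; have := H z Dz; rewrite /rvalue big_cons /= indicE mem_set // mulr1.
  by rewrite addrA.
- apply: IH => //; first exact: borelD.
  move=> z [Dz dz]; have := H z Dz; rewrite /rvalue big_cons /= indicE memNset // mulr0.
  by rewrite add0r.
Qed.

(** Adding [c] brings the values into [[0, 2c]]. Testing the hull with the translate by
    [- c E(setT) f] leaves [2c E(d) f - c E(setT) f], whence the factor 3. *)
Lemma rintegral_bound M c f (t : seq (R * set R[i])) :
  (forall d, borel d -> bounded_by M (E d)) -> (forall p, p \in t -> borel p.2) ->
  (forall z, `|rvalue t z| <= c) -> nrm (rintegral setT t f) <= 3 * M * c * nrm f.
Proof.
move=> HM bt Hc.
have c0 : 0 <= c by rewrite (le_trans _ (Hc 0)).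
have h : hull setT (c + c) f (c%:C *: E setT f + rintegral setT t f).
  apply: hull_rintegral => //; first exact: borelT.
  by move=> z _; have := Hc z; rewrite ler_norml => /andP[? ?]; apply/andP; split; lra.
have := h (- (c%:C *: E setT f)) (3 * M * c * nrm f).
rewrite addrAC subrr add0r; apply => d bd _.
rewrite (le_trans (nrmB _ _)) // !nrmZ !nrm_real !ger0_norm ?addr_ge0 //.
by have := HM d bd f; have := HM setT borelT f; nra.
Qed.

(** The real and imaginary parts contribute [3 M c] each. All bounds of the functional calculus go
    back to this one. *)
Lemma SI_bound M c f s : (forall d, borel d -> bounded_by M (E d)) -> borels s ->
  (forall z, nrm (simple_fun s z) <= c) -> nrm (SI s f) <= 6 * M * c * nrm f.
Proof.
move=> HM bs Hc.
pose sr := [seq (complex.Re p.1, p.2) | p <- s].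
pose si := [seq (complex.Im p.1, p.2) | p <- s].
have -> : SI s f = rintegral setT sr f + 'i *: rintegral setT si f.
  rewrite /rintegral !big_map scaler_sumr -big_split; apply: eq_bigr => p _ /=.
  by rewrite scalerA -scalerDl -complexE.
have i1 : nrm ('i : R[i]) = 1 by rewrite nrm_sqrt /= expr0n add0r expr1n sqrtr1.
rewrite (le_trans (nrmD _ _)) // nrmZ i1 mul1r.
have hr z : rvalue sr z = complex.Re (simple_fun s z).
  rewrite /rvalue big_map /simple_fun; elim: (s) => [|p t IH]; first by rewrite !big_nil.
  rewrite !big_cons IH raddfD /= !indicE; congr (_ + _).
  by case: (_ \in _); rewrite ?mulr1 ?mulr0.
have hi z : rvalue si z = complex.Im (simple_fun s z).
  rewrite /rvalue big_map /simple_fun; elim: (s) => [|p t IH]; first by rewrite !big_nil.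
  rewrite !big_cons IH raddfD /= !indicE; congr (_ + _).
  by case: (_ \in _); rewrite ?mulr1 ?mulr0.
have hr' : nrm (rintegral setT sr f) <= 3 * M * c * nrm f.
  apply: rintegral_bound => // [p /mapP[q /bs bq ->] //|z].
  by rewrite hr (le_trans (Re_le_nrm _)).
have hi' : nrm (rintegral setT si f) <= 3 * M * c * nrm f.
  apply: rintegral_bound => // [p /mapP[q /bs bq ->] //|z].
  by rewrite hi (le_trans (Im_le_nrm _)).
lra.
Qed.

End FunctionalCalculus.

(** * Uniform approximation by simple functions *)

Section BorelFunctions.
Context {R : realType}.
Implicit Types (D : set R[i]) (F G : R[i] -> R[i]).

Lemma sum_leq_truncn (x : R) L : 0 <= x ->
  (\sum_(j <- iota 1 L) (j%:R <= x)%R)%N = minn L (Num.truncn x).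
Proof.
move=> x0; elim: L => [|L IH]; first by rewrite big_nil min0n.
rewrite -[X in iota 1 X]addn1 iotaD big_cat /= big_seq1 IH add1n -truncn_ge_nat //.
by case: leqP => h; lia.
Qed.

(** The layers [e 1_{g >= - C + e j}], for [j] from 1 to [L], add up to [e] times the integer part
    of [(g + C) / e]. As [L] exceeds [2 C / e], no layer is missing, and the error is less than
    [e]. *)
Lemma simple_limit_real (g : R[i] -> R) (C : R) :
  (forall c, borel [set z | c <= g z]) -> (forall z, `|g z| <= C) ->
  simple_limit (fun z => (g z)%:C).
Proof.
move=> bg gC e e0.
pose L := (Num.bound ((C + C) / e)).
pose A j := [set z | - C + e * j%:R <= g z].
exists ((- C%:C, setT) :: [seq (e%:C, A j) | j <- iota 1 L]).
  apply/borels_cons; split; first exact: borelT.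
  by move=> _ /mapP[j _ ->]; exact: bg.
move=> z; rewrite /simple_fun big_cons big_map /= indicT mulr1 -mulr_sumr.
have C0 : 0 <= C by rewrite (le_trans _ (gC z)).
have /andP[g1 g2] : - C <= g z <= C by rewrite -ler_norml.
pose x := (g z + C) / e.
have x0 : 0 <= x by rewrite divr_ge0 ?(ltW e0) //; lra.
have -> : \sum_(j <- iota 1 L) \1_(A j) z = (Num.truncn x)%:R%:C :> R[i].
  have -> : Num.truncn x = minn L (Num.truncn x).
    apply/esym/minn_idPr; rewrite -(ler_nat R) (le_trans (_ : _ <= x)) ?truncn_le_nat ?truncn_le //.
    have xL : x <= (C + C) / e by rewrite ler_pM2r ?invr_gt0 //; lra.
    by rewrite (le_trans xL) // ltW // archi_boundP // divr_ge0 ?(ltW e0) //; lra.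
  rewrite -sum_leq_truncn // rmorph_nat natr_sum; apply: eq_bigr => j _.
  rewrite indicE; congr (nat_of_bool _)%:R.
  have -> : (j%:R <= x) = (- C + e * j%:R <= g z).
    by rewrite /x ler_pdivlMr // mulrC; apply/idP/idP; lra.
  by apply/idP/idP => [/set_mem|?]; last exact: mem_set.
rewrite -!rmorphM -!rmorphN -!rmorphD -rmorphB /= nrm_real.
have -> : g z - (- C + e * (Num.truncn x)%:R) = e * (x - (Num.truncn x)%:R).
  by rewrite /x; field; rewrite gt_eqF.
have /andP[t1 t2] := truncn_itv x0.
rewrite ger0_norm; last by rewrite mulr_ge0 ?(ltW e0) // subr_ge0.
by rewrite ler_piMr ?(ltW e0) //; move: t2; rewrite -natr1; lra.
Qed.

(** Continuity is asked only on an open [W] around [D], so that the resolvent function, which has a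
    pole, is covered. [D] itself need not be open. *)
Lemma simple_limit_continuous (W D : set R[i]^o) (G : R[i]^o -> R[i]^o) (C : R) :
  open W -> borel (D : set R[i]) -> D `<=` W ->
  (forall z, W z -> G w @[w --> z] --> G z) -> (forall z, D z -> nrm (G z) <= C) ->
  simple_limit (fun z : R[i] => \1_D z * G z).
Proof.
move=> oW bD DW cG GC.
have real_part (p : R[i] -> R) : (forall z w, `|p z - p w| <= nrm (z - w)) ->
  (forall z, `|p z| <= nrm z) -> p 0 = 0 ->
    simple_limit (fun z : R[i] => (p (\1_D z * G z))%:C).
  move=> p1 p2 p0; apply: (@simple_limit_real _ `|C|); last first.
    move=> z; rewrite (le_trans (p2 _)) // nrmM indicE.
    have [/set_mem Dz|_] := boolP (_ \in _); last by rewrite nrm0 mul0r.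
    by rewrite nrm1 mul1r (le_trans (GC z Dz)) // ler_norm.
  move=> c.
  pose V := [set z | W z /\ p (G z) < c].
  have bV : borel (V : set R[i]).
    apply: borel_open; apply/open_nrmP => z [Wz pz].
    have /(@open_nrmP _ R[i]^o)/(_ z Wz)[d1 d10 H1] := oW.
    have /(@cvg_at_nrmP _ R[i]^o R[i]^o) := cG z Wz.
    have pz' : 0 < c - p (G z) by lra.
    move=> /(_ _ pz')[d2 d20 H2].
    exists (Num.min d1 d2); first by rewrite lt_min d10.
    move=> w; rewrite lt_min => /andP[/H1 h1 /H2 h2]; split => //.
    have := p1 (G w) (G z); rewrite ler_norml => /andP[]; lra.
  (* Off [D] the function is 0, so the complement of [D] belongs to the superlevel set exactly when
     [c <= 0]. *)
  have -> : [set z | c <= p (\1_D z * G z)] = (D `\` V) `|` (if c <= 0 then ~` D else set0).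
    apply/seteqP; split=> z /=; rewrite indicE.
      have [/set_mem Dz|/negP Dz] := boolP (_ \in _).
        by rewrite mul1r => h; left; split=> // -[_]; rewrite ltNge h.
      by rewrite mul0r p0 => ->; right => /mem_set.
    case=> [[Dz nV]|].
      rewrite mem_set // mul1r leNgt; apply/negP => h; apply: nV; split => //; exact: DW.
    by case: ifP => // c0 /= nD; rewrite memNset // mul0r p0.
  apply: borelU; first exact: borelD.
  by case: ifP => _; [exact: borelC|exact: borel0].
have hr := @real_part (@complex.Re R) _ _ _.
have hi := @real_part (@complex.Im R) _ _ _.
have -> : (fun z : R[i] => \1_D z * G z)
  = (fun z => (complex.Re (\1_D z * G z))%:C + 'i * (complex.Im (\1_D z * G z))%:C).
  by apply/funext => z; rewrite -complexE.
apply: simple_limitD; first by apply: hr => // [z w|z]; rewrite -?raddfB Re_le_nrm.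
apply: simple_limitM; first exact: simple_limit_cst.
by apply: hi => // [z w|z]; rewrite -?raddfB Im_le_nrm.
Qed.

End BorelFunctions.

(** * The integral of a bounded Borel function *)

Section BoundedIntegral.
Context {R : realType} {X : completeNormedModType R[i]}.
Variable E : set R[i] -> X -> X.
Hypothesis hE : spectral_measure E.
Implicit Types (d D : set R[i]) (s : seq (R[i] * set R[i])) (F G : R[i] -> R[i]) (f x y : X).

(* Junk unless [F] is a [simple_limit]. *)
Definition bint F f : X := get [set y | exists K : R, forall s (e : R), borels s ->
  (forall z, nrm (F z - simple_fun s z) <= e) -> nrm (y - SI E s f) <= K * e].

Lemma null_sequence : exists r : nat -> R, (forall n, 0 < r n) /\
  forall e : R, 0 < e -> exists N, forall n, (N <= n)%N -> r n < e.
Proof.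
exists (fun n => n.+1%:R^-1); split=> [n|e e0]; first by rewrite invr_gt0.
exists (Num.bound e^-1) => n Nn; rewrite invf_plt ?posrE //.
by rewrite (lt_le_trans (archi_boundP _)) ?invr_ge0 ?(ltW e0) // ler_nat leqW.
Qed.

Lemma SI_lipschitz : exists2 K : R, 0 < K & forall s s' c f, borels s -> borels s' ->
  (forall z, nrm (simple_fun s z - simple_fun s' z) <= c) ->
  nrm (SI E s f - SI E s' f) <= K * c * nrm f.
Proof.
have [M M0 HM] := E_uniformly_bounded hE; exists (6 * M); first by rewrite mulr_gt0.
move=> s s' c f bs bs' H; rewrite -scaleN1r -SI_scales -SI_cat.
apply: SI_bound => // [|z].
  by apply: borels_cat => //; exact: borels_scales.
by rewrite simple_fun_cat simple_fun_scales mulN1r.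
Qed.

(** The constant inside the definition of [bint] may depend on [F] and [f]. It is enough to identify
    the chosen value with the limit of the integrals of approximating simple functions, and that
    limit inherits the uniform constant of [SI_lipschitz]. *)
Lemma bint_spec : exists2 K : R, 0 < K & forall F f s (e : R), simple_limit F -> borels s ->
  (forall z, nrm (F z - simple_fun s z) <= e) -> nrm (bint F f - SI E s f) <= K * e * nrm f.
Proof.
have [K K0 HK] := SI_lipschitz; exists K => // F f s e lF bs Hs.
have [r [r0 rlim]] := null_sequence.
have /choice[t Ht] n : exists t, borels t /\ forall z, nrm (F z - simple_fun t z) <= r n.
  by have [t bt Ht] := lF _ (r0 n); exists t.
have near_t s' e' n : borels s' -> (forall z, nrm (F z - simple_fun s' z) <= e') ->
    nrm (SI E (t n) f - SI E s' f) <= K * (e' + r n) * nrm f.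
  move=> bs' Hs'; have [bt Htn] := Ht n; apply: HK => // z.
  have := nrm_trans (F z) (simple_fun (t n) z) (simple_fun s' z).
  by have := Hs' z; have := Htn z; rewrite (nrmBC (simple_fun (t n) z) (F z)); lra.
have small (d : R) : 0 < d -> exists N, forall n, (N <= n)%N -> K * r n * nrm f < d.
  move=> d0; have c0 : 0 < K * (nrm f + 1) by rewrite mulr_gt0 // ltr_wpDl ?nrm_ge0.
  have [N HN] := rlim _ (divr_gt0 d0 c0); exists N => n /HN; rewrite ltr_pdivlMr //.
  by apply: le_lt_trans; have := mulr_gt0 K0 (r0 n); lra.
have [y Hy] : exists y, (fun n => SI E (t n) f) @ \oo --> y.
  apply: seq_complete => d d0; have [N HN] := small (d / 2) (divr_gt0 d0 (ltr0Sn _ 1)).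
  exists N => n Nn; have [bt Htn] := Ht n.
  rewrite (le_lt_trans (near_t _ _ N bt Htn)) //.
  by have := HN N (leqnn N); have := HN n Nn; lra.
have Hy' : [set y | exists K : R, forall s (e : R), borels s ->
  (forall z, nrm (F z - simple_fun s z) <= e) -> nrm (y - SI E s f) <= K * e] y.
  exists (K * nrm f) => s' e' bs' Hs'; apply/ler_addgt0Pr => d d0.
  have d2 : 0 < d / 2 by rewrite divr_gt0.
  have [N1 H1] := small _ d2; have [N2 H2] := (cvg_seqP _ _).1 Hy _ d2.
  have := H1 (N1 + N2)%N (leq_addr _ _); have := H2 (N1 + N2)%N (leq_addl _ _).
  have := near_t s' e' (N1 + N2)%N bs' Hs'.
  have := nrm_trans (SI E (t (N1 + N2)%N) f) y (SI E s' f).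
  by rewrite (nrmBC y (SI E (t (N1 + N2)%N) f)); lra.
have [K' HK'] := xgetPex point (ex_intro _ y Hy').
have -> : bint F f = y.
  apply/eqP; rewrite -subr_eq0; apply/eqP; apply: nrm_le0 => d d0.
  have d2 : 0 < d / 2 by rewrite divr_gt0.
  have K1 : 0 < `|K'| + 1 by rewrite ltr_wpDl.
  have [N2 H2] := (cvg_seqP _ _).1 Hy _ d2.
  have [N1 H1] := rlim _ (divr_gt0 d2 K1).
  pose n := (N1 + N2)%N.
  have [bt Htn] := Ht n.
  have := HK' _ _ bt Htn; have := H2 n (leq_addl _ _).
  have := nrm_trans (SI E (t n) f) (bint F f) y.
  have := H1 n (leq_addr _ _); rewrite ltr_pdivlMr // => h1.
  have : K' * r n <= (`|K'| + 1) * r n.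
    by rewrite ler_wpM2r ?(ltW (r0 n)) //; have := ler_norm K'; lra.
  rewrite /bint; lra.
apply/ler_addgt0Pr => d d0.
have d2 : 0 < d / 2 by rewrite divr_gt0.
have [N1 H1] := small _ d2; have [N2 H2] := (cvg_seqP _ _).1 Hy _ d2.
have := H1 (N1 + N2)%N (leq_addr _ _); have := H2 (N1 + N2)%N (leq_addl _ _).
have := near_t s e (N1 + N2)%N bs Hs.
have := nrm_trans (SI E (t (N1 + N2)%N) f) y (SI E s f).
by rewrite (nrmBC y (SI E (t (N1 + N2)%N) f)); lra.
Qed.

End BoundedIntegral.

Section BoundedIntegralTheory.
Context {R : realType} {X : completeNormedModType R[i]}.
Variable E : set R[i] -> X -> X.
Hypothesis hE : spectral_measure E.
Implicit Types (d D : set R[i]) (s : seq (R[i] * set R[i])) (F G : R[i] -> R[i]) (f x y : X).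

Lemma bint_approx F f (e : R) : simple_limit F -> 0 < e -> exists s,
  [/\ borels s, forall z, nrm (F z - simple_fun s z) <= e & nrm (bint E F f - SI E s f) <= e].
Proof.
move=> lF e0; have [K K0 HK] := bint_spec hE.
have c0 : 0 < K * (nrm f + 1) by rewrite mulr_gt0 // ltr_wpDl ?nrm_ge0.
have d0 : 0 < Num.min e (e / (K * (nrm f + 1))) by rewrite lt_min e0 divr_gt0.
have [s bs Hs] := lF _ d0; exists s; split => //.
  by move=> z; rewrite (le_trans (Hs z)) // ge_min lexx.
rewrite (le_trans (HK F f s _ lF bs Hs)) //; move: d0; set d := Num.min _ _ => d0.
have : d * (K * (nrm f + 1)) <= e by rewrite -ler_pdivlMr // ge_min lexx orbT.
by have := mulr_gt0 K0 d0; lra.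
Qed.

(** The working criterion for the identities below: a single list must serve both the function and
    the vector. It also yields that [F] is integrable. *)
Lemma bint_unique F f y : (forall e : R, 0 < e -> exists s,
  [/\ borels s, forall z, nrm (F z - simple_fun s z) <= e & nrm (y - SI E s f) <= e]) ->
  simple_limit F /\ bint E F f = y.
Proof.
move=> H; have lF : simple_limit F by move=> e /H [s [bs Hs _]]; exists s.
split => //; apply/eqP; rewrite -subr_eq0; apply/eqP; apply: nrm_le0 => e e0.
have [K K0 HK] := bint_spec hE.
have c0 : 0 < K * nrm f + 1 by rewrite ltr_wpDl // mulr_ge0 ?nrm_ge0 ?(ltW K0).
have [s [bs Hs Hy]] := H _ (divr_gt0 e0 c0).
have := HK F f s _ lF bs Hs; have := nrm_trans (SI E s f) (bint E F f) y.
have : e / (K * nrm f + 1) * (K * nrm f + 1) = e by rewrite divfK // lt0r_neq0.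
rewrite nrmBC in Hy; move: Hy; set q := e / _ => Hy; lra.
Qed.

Lemma bintD F G f : simple_limit F -> simple_limit G ->
  bint E (fun z => F z + G z) f = bint E F f + bint E G f.
Proof.
move=> lF lG; apply: (proj2 (bint_unique _)) => e e0.
have e2 : 0 < e / 2 by rewrite divr_gt0.
have [s [bs Hs Is]] := bint_approx f lF e2; have [t [bt Ht It]] := bint_approx f lG e2.
exists (s ++ t); split=> [|z|]; first exact: borels_cat.
  rewrite simple_fun_cat opprD addrACA.
  by have := nrmD (F z - simple_fun s z) (G z - simple_fun t z); have := Hs z; have := Ht z; lra.
rewrite SI_cat opprD addrACA.
by have := nrmD (bint E F f - SI E s f) (bint E G f - SI E t f); lra.
Qed.

Lemma bintM F G f : simple_limit F -> simple_limit G ->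
  bint E (fun z => F z * G z) f = bint E F (bint E G f).
Proof.
move=> lF lG; apply: (proj2 (bint_unique _)) => e e0.
have [CG CG0 HG] := simple_limit_bounded lG.
have CG1 : 0 < CG + 1 by lra.
have d0 : 0 < e / 2 / (CG + 1) by rewrite !divr_gt0.
(* [s] is tested on the vector [bint E G f]; [t] comes later because its accuracy depends on the
   bound [C] of [s]. The factor [(1 + K) (1 + C)] dominates both [C], met for functions, and [K C],
   met for vectors. *)
have [s [bs Hs Is]] := bint_approx (bint E G f) lF d0.
have [C C0 HC] := simple_fun_bounded s.
have [K K0 HK] := SI_lipschitz hE.
have SIb x : nrm (SI E s x) <= K * C * nrm x.
  have := HK s [::] C x bs; rewrite SI_nil subr0; apply => // z.
  by rewrite simple_fun_nil subr0.
have C1 : 0 < (1 + K) * (1 + C) by rewrite mulr_gt0 //; lra.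
have d0' : 0 < e / 2 / ((1 + K) * (1 + C)) by rewrite divr_gt0 // divr_gt0.
have [t [bt Ht It]] := bint_approx f lG d0'.
have h1 : e / 2 / (CG + 1) * (CG + 1) = e / 2 by rewrite divfK // lt0r_neq0.
have h2 : e / 2 / ((1 + K) * (1 + C)) * ((1 + K) * (1 + C)) = e / 2 by rewrite divfK // lt0r_neq0.
move: d0 d0' Hs Is Ht It h1 h2; set d := e / 2 / (CG + 1); set d' := e / 2 / (_ * _).
move=> d0 d0' Hs Is Ht It h1 h2.
exists (muls s t); split=> [|z|]; first exact: borels_muls.
  rewrite simple_fun_muls.
  have -> : F z * G z - simple_fun s z * simple_fun t z =
    (F z - simple_fun s z) * G z + simple_fun s z * (G z - simple_fun t z) by ring.
  rewrite (le_trans (nrmD _ _)) // !nrmM.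
  have : nrm (F z - simple_fun s z) * nrm (G z) <= d * CG by rewrite ler_pM ?nrm_ge0.
  have : nrm (simple_fun s z) * nrm (G z - simple_fun t z) <= C * d' by rewrite ler_pM ?nrm_ge0.
  by have := mulr_ge0 C0 (ltW K0); nra.
rewrite (SI_muls hE) //.
have := nrm_trans (SI E s (bint E G f)) (bint E F (bint E G f)) (SI E s (SI E t f)).
rewrite -(linopB _ _ (SI_linear hE bs)).
have := SIb (bint E G f - SI E t f).
have : K * C * nrm (bint E G f - SI E t f) <= K * C * d'.
  by rewrite ler_wpM2l // mulr_ge0 // ltW.
by have := mulr_ge0 C0 (ltW K0); nra.
Qed.

Lemma bint_indic d f : borel d -> bint E (\1_d : R[i] -> R[i]) f = E d f.
Proof.
move=> bd; apply: (proj2 (bint_unique _)) => e e0; exists [:: (1, d)]; split.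
- by move=> p; rewrite inE => /eqP ->.
- by move=> z; rewrite /simple_fun big_seq1 mul1r subrr nrm0 ltW.
- by rewrite /SI /simple_integral big_seq1 setIT scale1r subrr nrm0 ltW.
Qed.

Lemma bint_cst c f : bint E (fun=> c) f = c *: f.
Proof.
apply: (proj2 (bint_unique _)) => e e0; exists [:: (c, setT)]; split.
- by move=> p; rewrite inE => /eqP -> /=; exact: borelT.
- by move=> z; rewrite /simple_fun big_seq1 indicT mulr1 subrr nrm0 ltW.
- by rewrite /SI /simple_integral big_seq1 setIT (E_setT hE) subrr nrm0 ltW.
Qed.

Lemma bintZ c F f : simple_limit F -> bint E (fun z => c * F z) f = c *: bint E F f.
Proof. by move=> lF; rewrite bintM //; [rewrite bint_cst|exact: simple_limit_cst]. Qed.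

Lemma simple_limitZ c F : simple_limit F -> simple_limit (fun z => c * F z).
Proof. by move=> lF; apply: simple_limitM => //; exact: simple_limit_cst. Qed.

Lemma simple_limitB F G : simple_limit F -> simple_limit G -> simple_limit (fun z => F z - G z).
Proof.
move=> lF lG; have -> : (fun z => F z - G z) = (fun z => F z + (-1) * G z).
  by apply/funext => z; rewrite mulN1r.
by apply: simple_limitD => //; exact: simple_limitZ.
Qed.

Lemma bintB F G f : simple_limit F -> simple_limit G ->
  bint E (fun z => F z - G z) f = bint E F f - bint E G f.
Proof.
move=> lF lG; have -> : (fun z => F z - G z) = (fun z => F z + (-1) * G z).
  by apply/funext => z; rewrite mulN1r.
by rewrite bintD //; [rewrite bintZ // scaleN1r|exact: simple_limitZ].
Qed.

(** One list has to work for [x], [y] and [c x + y] together, so the uniform estimate [bint_spec] is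
    used and not [bint_approx], whose list depends on the vector. *)
Lemma bint_linear F : simple_limit F -> linear (bint E F).
Proof.
move=> lF c x y; apply: (proj2 (bint_unique _)) => e e0.
have c1 : 0 < nrm c + 1 by rewrite ltr_wpDl ?nrm_ge0.
have [K K0 HK] := bint_spec hE.
have C0 : 0 < 1 + K * (nrm c * nrm x + nrm y).
  by rewrite ltr_wpDr // mulr_ge0 ?(ltW K0) // addr_ge0 ?mulr_ge0 ?nrm_ge0.
have d0 : 0 < Num.min e (e / (1 + K * (nrm c * nrm x + nrm y))) by rewrite lt_min e0 divr_gt0.
have [s bs Hs] := lF _ d0; exists s; split=> // [z|].
  by rewrite (le_trans (Hs z)) // ge_min lexx.
rewrite (SI_linear hE bs) opprD addrACA -scalerBr (le_trans (nrmD _ _)) // nrmZ.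
have := HK F x s _ lF bs Hs; have := HK F y s _ lF bs Hs; move: d0; set d := Num.min _ _ => d0.
have : d * (1 + K * (nrm c * nrm x + nrm y)) <= e by rewrite -ler_pdivlMr // ge_min lexx orbT.
move=> h hy hx.
have : nrm c * nrm (bint E F x - SI E s x) <= nrm c * (K * d * nrm x) by rewrite ler_wpM2l ?nrm_ge0.
lra.
Qed.

Lemma bint_bound : exists2 K : R, 0 < K & forall F c, simple_limit F ->
  (forall z, nrm (F z) <= c) -> bounded_by (K * c) (bint E F).
Proof.
have [K K0 HK] := bint_spec hE; exists K => // F c lF Hc x.
have := HK F x [::] c lF; rewrite SI_nil subr0; apply => // z.
by rewrite simple_fun_nil subr0.
Qed.

Lemma bint_bounded F : simple_limit F -> bounded_operator (bint E F).
Proof.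
move=> lF; have [K K0 HK] := bint_bound; have [C C0 HC] := simple_limit_bounded lF.
exact: bounded_by_op (bint_linear lF) (HK F C lF HC).
Qed.

Lemma bint_indicM D F f : borel D -> simple_limit F ->
  bint E (fun z => \1_D z * F z) f = E D (bint E F f).
Proof. by move=> bD lF; rewrite bintM ?bint_indic //; exact: simple_limit_indic. Qed.

Lemma bint_Mindic D F f : borel D -> simple_limit F ->
  bint E (fun z => \1_D z * F z) f = bint E F (E D f).
Proof.
move=> bD lF; rewrite -(bint_indic _ bD) -bintM //; last exact: simple_limit_indic.
by congr (bint _ _ _); apply/funext => z; rewrite mulrC.
Qed.

Lemma bint_commute F G f : simple_limit F -> simple_limit G ->
  bint E F (bint E G f) = bint E G (bint E F f).
Proof.
move=> lF lG; rewrite -!bintM //; congr (bint _ _ _).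
by apply/funext => z; rewrite mulrC.
Qed.

Lemma bounded_integralP D F f y : borel D ->
  is_bounded_integral E D F f y <->
  simple_limit (fun z => \1_D z * F z) /\ bint E (fun z => \1_D z * F z) f = y.
Proof.
move=> bD; split.
  case=> s [bs Hs cvs]; apply: bint_unique => e e0.
  have [N HN] := (cvg_seqP _ _).1 cvs e e0; have [N' _ HN'] := Hs e e0.
  pose n := (N + N')%N.
  (* Approximation is known only on [D]; multiplying by the indicator makes it global. *)
  exists (muls [:: (1, D)] (s n)); split.
  - apply: borels_muls; last exact: bs.
    by move=> p; rewrite inE => /eqP ->.
  - move=> z; rewrite simple_fun_muls {1}/simple_fun big_seq1 /= mul1r -mulrBr nrmM indicE.
    have [/set_mem Dz|_] := boolP (_ \in _); last by rewrite nrm0 mul0r ltW.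
    by rewrite nrm1 mul1r; have := HN' n (leq_addl _ _) z Dz; rewrite nrmE lecR.
  - have -> : SI E (muls [:: (1, D)] (s n)) f = simple_integral E D (s n) f.
      rewrite /SI /simple_integral /muls /= cats0 big_map; apply: eq_bigr => p _ /=.
      by rewrite mul1r setIT setIC.
    by rewrite nrmBC ltW // HN // leq_addr.
case=> lF Fy.
have [r [r0 rlim]] := @null_sequence R.
have /choice[s Hs] n := bint_approx f lF (r0 n).
exists s; split=> [n p|e e0|]; first by have [bs _ _] := Hs n; exact: bs.
  have [N HN] := rlim e e0; exists N => // n /HN/ltW rn z Dz.
  have [_ h _] := Hs n; rewrite nrmE lecR (le_trans _ rn) //.
  by have := h z; rewrite indic_in // mul1r.
(* Integrating [s n] over [D] amounts to applying [E D] to its full integral, and the limit already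
   lies in the range of [E D]. *)
have ED y' : E D (bint E (fun z => \1_D z * F z) y') = bint E (fun z => \1_D z * F z) y'.
  rewrite -bint_indicM //; congr (bint _ _ _); apply/funext => z.
  by rewrite mulrA indicE; case: (_ \in _); rewrite ?mul0r // !mul1r.
have [C C0 HC] := bounded_op_bound (E_bounded hE bD).
apply/cvg_seqP => e e0; have [N HN] := rlim _ (divr_gt0 e0 C0).
exists N => n /HN; rewrite ltr_pdivlMr // mulrC; apply: le_lt_trans.
have [bs _ Is] := Hs n.
have -> : simple_integral E D (s n) f = E D (SI E (s n) f).
  move: bs; rewrite /SI /simple_integral; elim: (s n) => [_|p t IH /borels_cons[bp bt]].
    by rewrite !big_nil (linop0 (E_linear hE bD)).
  rewrite !big_cons IH // (linopD _ _ (E_linear hE bD)) (linopZ _ _ (E_linear hE bD)).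
  by rewrite setIT setIC (E_setI hE).
rewrite -Fy -[X in _ - X]ED -(linopB _ _ (E_linear hE bD)) (le_trans (HC _)) // ler_pM2l //.
by rewrite nrmBC.
Qed.

End BoundedIntegralTheory.

(** * Supports and images of spectral measures *)

Section Support.
Context {R : realType} {X : completeNormedModType R[i]}.
Variable E : set R[i] -> X -> X.
Hypothesis hE : spectral_measure E.
Implicit Types (d D : set R[i]) (F G : R[i] -> R[i]) (f x y : X) (z w : R[i]).

Definition cball z (r : R) : set R[i] := [set w | nrm (w - z) < r].

Lemma open_cball z r : open (cball z r : set R[i]^o).
Proof.
apply/open_nrmP => w wz; exists (r - nrm (w - z)); first by rewrite subr_gt0.
by move=> v vw; rewrite /cball /=; have := nrm_trans w v z; lra.
Qed.

Lemma borel_cball z r : borel (cball z r).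
Proof. by apply: borel_open; exact: open_cball. Qed.

Lemma borel_nrm_le (r : R) : borel [set z : R[i] | nrm z <= r].
Proof.
have -> : [set z : R[i] | nrm z <= r] = ~` [set z : R[i] | r < nrm z].
  by apply/seteqP; split=> z /=; [rewrite leNgt => /negP|move/negP; rewrite -leNgt].
apply: borelC; apply: borel_open; apply/open_nrmP => w wz; exists (nrm w - r); first
  by rewrite subr_gt0.
by move=> v vw /=; have := nrm_trans v w 0; rewrite !subr0 (nrmBC w v); lra.
Qed.

Lemma supportN z : ~ Defs.support E z <-> exists2 r : R, 0 < r & forall f, E (cball z r) f = 0.
Proof.
split=> [H|[r r0 H] /(_ _ (@open_cball z r))]; last first.
  by case=> [|f []]; rewrite ?H // /cball /= subrr nrm0.
apply: contrapT => H'; apply: H => U oU Uz.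
have [r r0 rU] := (@open_nrmP _ R[i]^o _).1 oU z Uz.
apply: contrapT => H; apply: H'; exists r => // f.
have EU g : E U g = 0 by apply: contrapT => g0; apply: H; exists g.
have -> : cball z r = cball z r `&` (U : set R[i]) by apply/esym/setIidPl => w /rU.
rewrite (E_setI hE) ?EU ?(linop0 (E_linear hE (borel_cball z r))) //; first exact: borel_cball.
exact: borel_open.
Qed.

Lemma open_supportC : open (~` Defs.support E : set R[i]^o).
Proof.
apply/open_nrmP => z /supportN [r r0 H]; exists r => // w wz.
move=> /(_ _ (@open_cball z r) wz) [f]; exact.
Qed.

Lemma borel_support : borel (Defs.support E).
Proof. by rewrite -(setCK (Defs.support E)); apply: borelC; apply: borel_open;
  exact: open_supportC. Qed.

Lemma E_null_bigcup (d : nat -> set R[i]) f : (forall n, borel (d n)) ->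
  (forall n g, E (d n) g = 0) -> E (\bigcup_n d n) f = 0.
Proof.
move=> bd d0; rewrite seqDU_bigcup_eq.
have bs n : borel (seqDU d n).
  apply: borelD => //; elim: n => [|n IH]; first by rewrite big_ord0; exact: borel0.
  by rewrite big_ord_recr /=; exact: borelU.
have s0 n g : E (seqDU d n) g = 0.
  have -> : seqDU d n = seqDU d n `&` d n by apply/esym/setIidPl; exact: subset_seqDU.
  by rewrite (E_setI hE) // d0 (linop0 (E_linear hE (bs n))).
apply: (cvg_seq_unique (E_bigcup hE bs (@trivIset_seqDU _ d))).
apply/cvg_seqP => e e0; exists 0%N => n _.
by rewrite /series /= big1 ?subrr ?nrm0.
Qed.

Definition rational_ball (p : rat * rat * nat) : set R[i] :=
  cball (ratr p.1.1 +i* ratr p.1.2) (p.2.+1%:R^-1).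

Lemma rational_ballP z (r : R) : 0 < r ->
  exists2 p, rational_ball p z & rational_ball p `<=` cball z r.
Proof.
move=> r0; have r2 : 0 < r / 2 by rewrite divr_gt0.
have [n Hn] : exists n : nat, n.+1%:R^-1 < r / 2.
  exists (Num.bound (r / 2)^-1); rewrite invf_plt ?posrE //.
  by rewrite (lt_trans (archi_boundP _)) ?invr_ge0 ?(ltW r2) // ltr_nat.
have q0 : 0 < n.+1%:R^-1 :> R by rewrite invr_gt0.
move: Hn q0; set q := n.+1%:R^-1 => Hn q0.
have near_rat (x : R) : exists a : rat, `|x - ratr a| < q / 2.
  have [|a] := @rat_in_itvoo R (x - q / 2) (x + q / 2); first by lra.
  rewrite in_itv /= => /andP[a1 a2]; exists a.
  by rewrite ltr_norml; apply/andP; split; lra.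
have [a Ha] := near_rat (complex.Re z); have [b Hb] := near_rat (complex.Im z).
have zq : nrm (z - (ratr a +i* ratr b)) < q.
  rewrite (le_lt_trans (nrm_le_ReIm _)) //; move: Ha Hb; case: (z) => x y /=; lra.
exists (a, b, n) => // w wz; have wq : nrm (w - (ratr a +i* ratr b)) < q := wz.
rewrite /cball /=; have := nrm_trans (ratr a +i* ratr b) w z.
by rewrite (nrmBC (ratr a +i* ratr b) z); lra.
Qed.

(** Each point off the support has a null neighbourhood, but only countable unions of null sets are
    known to be null. Hence the balls with rational centres and radii [1 / n], enumerated by
    [unpickle], those that are not null being replaced by [set0]. *)
Lemma E_supportC f : E (~` Defs.support E) f = 0.
Proof.
pose d (k : nat) := if unpickle k is Some p then
  (if pselect (forall g, E (rational_ball p) g = 0) then rational_ball p else set0) else set0.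
have -> : ~` Defs.support E = \bigcup_k d k.
  apply/seteqP; split=> z.
    move/supportN => [r r0 H]; have [p pz pr] := rational_ballP z r0.
    exists (pickle p); [exact: I|rewrite /d pickleK].
    case: pselect => [//|[]] g.
    have -> : rational_ball p = rational_ball p `&` cball z r by apply/esym/setIidPl.
    by rewrite (E_setI hE) ?H ?(linop0 (E_linear hE _)) //; exact: borel_cball.
  case=> k _; rewrite /d; case: unpickle => // p; case: pselect => // H pz.
  by move=> /(_ _ (@open_cball _ _) pz) [g]; exact.
apply: E_null_bigcup => [k|k g]; rewrite /d; case: unpickle => [p|].
- by case: pselect => ?; [exact: borel_cball|exact: borel0].
- exact: borel0.
- by case: pselect => [h|?]; rewrite ?h // (E_set0 hE).
- by rewrite (E_set0 hE).
Qed.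

Lemma E_full D f : borel D -> (forall g, E (~` D) g = 0) -> E D f = f.
Proof.
move=> bD h; rewrite -[RHS](E_setT hE) (E_setIC hE f bD borelT) setTI.
by rewrite setTD h addr0.
Qed.

Lemma E_support f : E (Defs.support E) f = f.
Proof. by apply: E_full; [exact: borel_support|move=> g; exact: E_supportC]. Qed.

Lemma bint_eq_on D F G f : borel D -> (forall g, E D g = g) -> simple_limit F -> simple_limit G ->
  (forall z, D z -> F z = G z) -> bint E F f = bint E G f.
Proof.
move=> bD ED lF lG FG; rewrite -(ED (bint E F f)) -(ED (bint E G f)) -!bint_indicM //.
congr (bint _ _ _); apply/funext => z; rewrite indicE.
by have [/set_mem/FG ->|_] := boolP (_ \in _); rewrite // !mul0r.
Qed.

(** On the range of [E D] the calculus sees [F] only on [D]. With [D] a small piece around a point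
    of the support, this produces approximate eigenvectors. *)
Lemma bint_near_scalar : exists2 K : R, 0 < K & forall D F c e x, borel D -> simple_limit F ->
  E D x = x -> 0 <= e -> (forall z, D z -> nrm (F z - c) <= e) ->
  nrm (bint E F x - c *: x) <= K * e * nrm x.
Proof.
have [K K0 HK] := bint_bound hE; exists K => // D F c e x bD lF Ex e0 H.
have lc : simple_limit (fun=> c) := simple_limit_cst c.
have lFc := simple_limitB lF lc.
rewrite -(bint_cst hE c x) -bintB //= -{1}Ex -bint_Mindic //.
apply: HK; first by apply: simple_limitM => //; exact: simple_limit_indic.
move=> z; rewrite nrmM indicE.
have [/set_mem/H h|_] := boolP (_ \in _); last by rewrite nrm0 mul0r.
by rewrite nrm1 mul1r.
Qed.

Definition trunc_id D (n : nat) z := \1_(D `&` [set w | nrm w <= n%:R]) z * z.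

Lemma simple_limit_trunc_id D n : borel D -> simple_limit (trunc_id D n).
Proof.
move=> bD; apply: (@simple_limit_continuous _ setT _ id n%:R) => //.
- exact: openT.
- apply: borelI => //; exact: borel_nrm_le.
- by move=> z [].
Qed.

Lemma spectral_integral_idP D f y : borel D ->
  is_spectral_integral E D id f y <-> bint E (trunc_id D n) f @[n --> \oo] --> y.
Proof.
move=> bD.
have eD n : D `&` [set z | `|id z| <= n%:R] = D `&` [set w | nrm w <= n%:R].
  congr (_ `&` _); apply/seteqP; split=> z /=;
  by rewrite nrmE -(rmorph_nat (real_complex R)) lecR.
have bDn n : borel (D `&` [set w | nrm w <= n%:R]) by apply: borelI => //; exact: borel_nrm_le.
split=> [[u [Hu uy]]|H].
  suff -> : (fun n => bint E (trunc_id D n) f) = u by [].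
  apply/funext => n; have := Hu n; rewrite eD => /(bounded_integralP hE _ _ _ (bDn n)) [_ <-].
  by [].
exists (fun n => bint E (trunc_id D n) f); split => // n; rewrite eD.
by apply/(bounded_integralP hE _ _ _ (bDn n)); split => //; exact: simple_limit_trunc_id.
Qed.

End Support.

(** * Spectral measures of bounded support give scalar type operators *)

Section BoundedSupport.
Context {R : realType} {X : completeNormedModType R[i]}.
Variable E : set R[i] -> X -> X.
Hypothesis hE : spectral_measure E.
Variable C : R.
Hypothesis hC : forall z, Defs.support E z -> nrm z <= C.
Implicit Types (d D : set R[i]) (F G : R[i] -> R[i]) (f x y : X) (z w : R[i]).

Definition id_on D z : R[i] := \1_D z * z.

Lemma simple_limit_id_on_support : simple_limit (id_on (Defs.support E)).
Proof.
apply: (@simple_limit_continuous _ setT _ id C) => //; first exact: openT.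
exact: borel_support.
Qed.

Let S := Defs.support E.
Let B := bint E (id_on S).
Let lJ := simple_limit_id_on_support.

Lemma bounded_operator_closed (T : X -> X) : bounded_operator T ->
  densely_defined_closed_linear (everywhere_defined T).
Proof.
move=> bT; split.
- by split=> // c x y _ _; split=> //; exact: bT.1.
- by move=> O [x Ox] _; exists x.
have -> : graph (everywhere_defined T) = (fun p : X * X => T p.1 - p.2) @^-1` [set 0].
  apply/seteqP; split=> [p [_ /= ->]|p /= /eqP]; first by rewrite subrr.
  by rewrite subr_eq0 => /eqP.
apply: closed_comp => [p _|].
  apply: cvgB; last exact: cvg_snd.
  by apply: (@continuous_comp _ _ _ fst T); [exact: cvg_fst|exact: bT.2].
by apply: accessible_closed_set1; apply: hausdorff_accessible; exact: norm_hausdorff.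
Qed.

(** On the range of [E] of a ball of radius [e] about [z], [B - z] has size at most [K e]. An
    inverse bounded by [C1] would give [|x| <= C1 K e |x|], which is [|x| / 2] for the chosen [e],
    so the ball would be null. *)
Lemma support_sub_spectrum : S `<=` spectrum (everywhere_defined B).
Proof.
move=> z Sz [T bT [_ TB]].
have [C1 C10 HC1] := bounded_op_bound bT.
have [K K0 HK] := bint_near_scalar hE.
pose e := (2 * C1 * K)^-1.
have e0 : 0 < e by rewrite invr_gt0 !mulr_gt0.
have zz : cball z e z by rewrite /cball /= subrr nrm0.
have [f Ef] := Sz _ (@open_cball _ z e) zz; apply: Ef.
set x := E _ f.
have bU := borel_cball z e.
have bD : borel (cball z e `&` S) by apply: borelI => //; exact: borel_support.
have Ex : E (cball z e `&` S) x = x.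
  rewrite (E_setI hE) //; last exact: borel_support.
  by rewrite (E_support hE) /x -(E_setI hE) // setIid.
have h := HK _ _ z e x bD lJ Ex (ltW e0).
have {h} : nrm (B x - z *: x) <= K * e * nrm x.
  by apply: h => w [wz Sw]; rewrite /id_on indic_in // mul1r; exact: ltW.
have := HC1 (B x - z *: x); rewrite TB // => h1 h2.
have : C1 * nrm (B x - z *: x) <= C1 * (K * e * nrm x) by rewrite ler_pM2l.
have -> : C1 * (K * e * nrm x) = nrm x / 2.
  by rewrite /e; field; rewrite !gt_eqF.
move=> h3; apply: nrm_le0 => d d0; have := nrm_ge0 x; lra.
Qed.

(** Off the support the resolvent is the integral of [1 / (w - z)], bounded once a null ball around
    [z] is removed. *)
Lemma spectrum_sub_support : spectrum (everywhere_defined B) `<=` S.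
Proof.
move=> z sz; apply: contrapT => /(supportN hE) [e e0 He]; apply: sz.
pose D := ~` cball z e.
have bD : borel D by apply: borelC; exact: borel_cball.
have ED g : E D g = g.
  by apply: (E_full hE) => // g'; rewrite /D setCK He.
pose G w : R[i] := \1_D w * (w - z)^-1.
have lG : simple_limit G.
  apply: (@simple_limit_continuous _ [set w | w != z] D (fun w => (w - z)^-1) e^-1) => //.
  - apply/open_nrmP => w /= wz; exists (nrm (w - z)); first by rewrite nrm_gt0 subr_eq0.
    by move=> v; apply: contraTneq => ->; rewrite nrmBC ltxx.
  - by move=> w Dw; apply/eqP => wz; apply: Dw; rewrite /cball /= wz subrr nrm0.
  - move=> w /= wz; have wz0 : w - z != 0 by rewrite subr_eq0.
    have cw : (fun w : R[i]^o => (w - z) : R[i]^o) v @[v --> (w : R[i]^o)] --> (w - z : R[i]^o).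
      by apply: (@cvgB R[i] R[i]^o _ (nbhs (w : R[i]^o)) _ id (cst z) w z);
        [exact: cvg_id|exact: cvg_cst].
    exact: (@cvgV _ _ _ _ _ _ wz0 cw).
  - move=> w Dw; rewrite nrmV lef_pV2 ?posrE //; first by rewrite leNgt; apply/negP.
    by rewrite (lt_le_trans e0) // leNgt; apply/negP.
have lJz : simple_limit (fun w => id_on S w - z).
  by apply: simple_limitB => //; exact: simple_limit_cst.
have JE y : B y - z *: y = bint E (fun w => id_on S w - z) y.
  by rewrite (bintB hE) ?(bint_cst hE) //; exact: simple_limit_cst.
have bS := borel_support hE.
have one y : bint E (fun w => (id_on S w - z) * G w) y = y.
  rewrite -[RHS]scale1r -(bint_cst hE).
  apply: (@bint_eq_on _ _ _ hE (D `&` S)).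
  - exact: borelI.
  - by move=> g; rewrite (E_setI hE) // (E_support hE).
  - exact: simple_limitM.
  - exact: simple_limit_cst.
  move=> w [Dw Sw]; rewrite /id_on /G !indic_in // !mul1r divff // subr_eq0.
  by apply/eqP => wz; apply: Dw; rewrite /cball /= wz subrr nrm0.
exists (bint E G); first exact: bint_bounded.
split=> [y|x _]; first by split=> //=; rewrite JE -(bintM hE).
by rewrite /= JE (bint_commute hE) // -(bintM hE).
Qed.

Lemma bounded_support_scalar_type : scalar_type_spectral (everywhere_defined B).
Proof.
split; first by apply: bounded_operator_closed; exact: bint_bounded.
have sE : spectrum (everywhere_defined B) = S.
  by apply/seteqP; split; [exact: spectrum_sub_support|exact: support_sub_spectrum].
exists E; split=> //.
move=> f y; rewrite sE (spectral_integral_idP hE _ _ (borel_support hE)).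
have cv : bint E (trunc_id S n) f @[n --> \oo] --> B f.
  apply/cvg_seqP => e e0; exists (Num.bound `|C|) => n Cn.
  have -> : trunc_id S n = id_on S.
    apply/funext => z; rewrite /trunc_id /id_on; congr (\1_ _ _ * _).
    apply/setIidPl => w /hC /le_trans; apply.
    rewrite (le_trans (ler_norm C)) // (le_trans (ltW (archi_boundP _))) //.
    by rewrite ler_nat.
  by rewrite subrr nrm0.
split=> [[_ <-] //|h]; split=> //; exact: (cvg_seq_unique cv h).
Qed.

End BoundedSupport.

(** * Image of a spectral measure under a continuous map *)

Section Pushforward.
Context {R : realType} {X : completeNormedModType R[i]}.
Variable E : set R[i] -> X -> X.
Hypothesis hE : spectral_measure E.
Variable g : R[i]^o -> R[i]^o.
Hypothesis cg : continuous g.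

Lemma borel_preimage (d : set R[i]) : borel d -> borel (g @^-1` d : set R[i]).
Proof.
move: d; apply: smallest_sub; last first.
  by move=> U oU; apply: borel_open; apply: open_comp => // z _; exact: cg.
split=> [|d h|d h]; first by rewrite preimage_set0; exact: borel0.
- by rewrite setTD /= preimage_setC; exact: borelC.
- by rewrite /= preimage_bigcup; exact: borel_bigcup.
Qed.

Definition pushforward_measure (d : set R[i]) : X -> X := E (g @^-1` d).
Let E' := pushforward_measure.

Lemma spectral_measure_pushforward : spectral_measure E'.
Proof.
split.
- by move=> d bd; apply: (E_bounded hE); exact: borel_preimage.
- by move=> f; rewrite /E' /pushforward_measure preimage_set0 (E_set0 hE).
- by move=> f; rewrite /E' /pushforward_measure preimage_setT (E_setT hE).
- move=> d d' bd bd' f; rewrite /E' /pushforward_measure preimage_setI.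
  by rewrite (E_setI hE) //; exact: borel_preimage.
- move=> d bd td; rewrite /E' /pushforward_measure => f; rewrite preimage_bigcup.
  apply: (E_bigcup hE); first by move=> n; exact: borel_preimage.
  apply/trivIsetP => i j _ _ ij; rewrite -preimage_setI.
  by move/trivIsetP: td => /(_ i j I I ij) ->; rewrite preimage_set0.
Qed.

Lemma bint_pushforward F f : simple_limit F ->
  simple_limit (F \o g) /\ bint E (F \o g) f = bint E' F f.
Proof.
move=> lF; apply: (bint_unique hE) => e e0.
have [s [bs Hs Is]] := bint_approx spectral_measure_pushforward f lF e0.
exists [seq (p.1, g @^-1` p.2) | p <- s]; split.
- by move=> _ /mapP[p /bs bp ->]; exact: borel_preimage.
- move=> z; have := Hs (g z); congr (nrm (_ - _) <= _).
  rewrite /simple_fun big_map; apply: eq_bigr => p _ /=.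
  by rewrite !indicE; congr (_ * (nat_of_bool _)%:R); apply/idP/idP => /set_mem h; exact: mem_set.
have -> // : SI E [seq (p.1, g @^-1` p.2) | p <- s] f = SI E' s f.
rewrite /SI /simple_integral big_map; apply: eq_bigr => p _ /=.
by rewrite !setIT.
Qed.

End Pushforward.

(** * Semigroups *)

Section Semigroup.
Context {R : realType} {X : completeNormedModType R[i]}.
Implicit Types (f g x y : X) (s t h : R).

Lemma bounded_of_eventually (u : nat -> R) (C : R) N :
  (forall n, (N <= n)%N -> u n <= C) -> exists C', forall n, u n <= C'.
Proof.
elim: N C => [|N IH] C H; first by exists C => n; exact: H.
apply: (IH (Num.max C (u N))) => n; rewrite leq_eqVlt => /orP[/eqP <-|/H h].
  by rewrite le_max lexx orbT.
by rewrite le_max h.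
Qed.

Section OneSemigroup.
Variable T : R -> X -> X.
Hypothesis hT : C0_semigroup T.

Lemma sg_bounded t : 0 <= t -> bounded_operator (T t).
Proof. by case: hT => h _ _ _; exact: h. Qed.

Lemma sg_linear t : 0 <= t -> linear (T t).
Proof. by case/sg_bounded. Qed.

Lemma sg0 f : T 0 f = f.
Proof. by case: hT => _ h _ _; exact: h. Qed.

Lemma sgD s t f : 0 <= s -> 0 <= t -> T (s + t) f = T s (T t f).
Proof. by case: hT => _ _ h _ ? ?; exact: h. Qed.

Lemma sg_cvg0 f : T t f @[t --> 0^'+] --> f.
Proof. by case: hT. Qed.

(** Otherwise there are times [s n] tending to 0 at which [T] exceeds [n.+1]. The orbits converge
    along them, hence are bounded, against uniform boundedness. *)
Lemma sg_bounded_near0 : exists d M : R, [/\ 0 < d, 1 <= M &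
  forall s, 0 <= s <= d -> bounded_by M (T s)].
Proof.
apply: contrapT => H.
have [r [r0 rlim]] := @null_sequence R.
have /choice[s Hs] n : exists s, 0 <= s <= r n /\ ~ bounded_by n.+1%:R (T s).
  apply: contrapT => H'; apply: H; exists (r n), n.+1%:R; split=> // [|s sr].
    by rewrite ler1n.
  by apply: contrapT => H''; apply: H'; exists s.
have [||C C0 HC] := @uniform_boundedness R X nat (fun n => T (s n)).
- by move=> n; have [/andP[s0 _] _] := Hs n; exact: sg_bounded.
- move=> x; have /cvg0rightP/(_ _ ltr01)[d d0 Hd] := @sg_cvg0 x.
  have [N HN] := rlim d d0.
  apply: (@bounded_of_eventually _ (nrm x + 1) N) => n Nn.
  have [/andP[s0 sr] _] := Hs n; have h1 := nrm_ge0 x.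
  have [sn0|sn0] := eqVneq (s n) 0; first by rewrite sn0 sg0; lra.
  have := Hd (s n); rewrite lt_neqAle eq_sym sn0 s0 => /(_ isT (le_lt_trans sr (HN n Nn))).
  have := nrmBl (T (s n) x) x; lra.
have [_ []] := Hs (Num.bound C) => x; rewrite (le_trans (HC _ _)) // ler_wpM2r ?nrm_ge0 //.
by rewrite (le_trans (ltW (archi_boundP (ltW C0)))) // ler_nat.
Qed.

Lemma sg_nat n h f : 0 <= h -> T (n.+1%:R * h) f = T (n%:R * h) (T h f).
Proof.
by move=> h0; rewrite -natr1 mulrDl mul1r sgD // mulr_ge0.
Qed.

Lemma sg_locally_bounded (t0 : R) : exists2 M : R, 1 <= M &
  forall s, 0 <= s <= t0 -> bounded_by M (T s).
Proof.
have [d [M [d0 M1 HM]]] := sg_bounded_near0.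
have M0 : 0 <= M by lra.
have pw n h : 0 <= h <= d -> bounded_by (M ^+ n) (T (n%:R * h)).
  move=> hd; elim: n => [|n IH] x; first by rewrite mul0r sg0 expr0 mul1r.
  have /andP[h0 _] := hd.
  by rewrite sg_nat // (le_trans (IH _)) // exprSr -mulrA ler_wpM2l ?exprn_ge0 // HM.
pose n := (Num.bound (`|t0| / d)).+1.
exists (M ^+ n); first by rewrite exprn_ege1.
move=> s /andP[s0 st].
have n0 : 0 < n%:R :> R by rewrite ltr0n.
have -> : s = n%:R * (s / n%:R) by rewrite mulrC divfK // lt0r_neq0.
apply: pw; rewrite divr_ge0 ?(ltW n0) //= ler_pdivrMr // mulrC -ler_pdivrMr //.
have : `|t0| / d <= n%:R.
  rewrite (le_trans (ltW (archi_boundP _))) ?divr_ge0 ?(ltW d0) // ler_nat.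
  exact: leqnSn.
by apply: le_trans; rewrite ler_pM2r ?invr_gt0 // (le_trans st) // ler_norm.
Qed.

Definition generator_at g y := (t^-1)%:C *: (T t g - g) @[t --> 0^'+] --> y.

Lemma generator_atP g y : generator_at g y -> forall e : R, 0 < e ->
  exists2 r : R, 0 < r & forall h, 0 < h -> h < r -> nrm (T h g - g - h%:C *: y) <= h * e.
Proof.
move=> /cvg0rightP H e /H [r r0 Hr]; exists r => // h h0 hr.
have := Hr h h0 hr; rewrite -(ltr_pM2l h0) => /ltW; apply: le_trans.
have -> : h * nrm ((h^-1)%:C *: (T h g - g) - y) = nrm (h%:C *: ((h^-1)%:C *: (T h g - g) - y)).
  by rewrite nrmZ nrm_real gtr0_norm.
by rewrite scalerBr scaleRK // lt0r_neq0.
Qed.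

Variables (M t0 : R).
Hypothesis M1 : 1 <= M.
Hypothesis HM : forall s, 0 <= s <= t0 -> bounded_by M (T s).

Let M0 : 0 < M := lt_le_trans ltr01 M1.

Lemma small_step (t r : R) : 0 < t -> 0 < r -> exists n : nat,
  [/\ 0 < t / n.+1%:R, t / n.+1%:R < r & n.+1%:R * (t / n.+1%:R) = t].
Proof.
move=> tp rp; exists (Num.bound (t / r)).
have n0 : 0 < (Num.bound (t / r)).+1%:R :> R by rewrite ltr0n.
split; first by rewrite divr_gt0.
  rewrite ltr_pdivrMr // mulrC -ltr_pdivrMr //.
  by rewrite (lt_trans (archi_boundP _)) ?divr_ge0 ?(ltW tp) ?(ltW rp) // ltr_nat.
by rewrite mulrC divfK // lt0r_neq0.
Qed.

(** A mean value inequality by subdivision: with [n h = t], the difference is the sum of the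
    [T(kh)(T(h)g - g)], each at most [M] times [nrm (T h g - g)], which is nearly [h |y|]. *)
Lemma semigroup_sub_le g y t : generator_at g y -> 0 <= t <= t0 ->
  nrm (T t g - g) <= t * M * nrm y.
Proof.
move=> gy /andP[]; rewrite le_eqVlt => /orP[/eqP <- _|tp tt0].
  by rewrite sg0 subrr nrm0 !mul0r.
have step n h : 0 <= h -> n%:R * h <= t0 -> nrm (T (n%:R * h) g - g) <=
  n%:R * (M * nrm (T h g - g)).
  move=> hp; elim: n => [_|n IH]; first by rewrite mul0r sg0 subrr nrm0 mul0r.
  rewrite -natr1 mulrDl mul1r => ht.
  have n0 : 0 <= n%:R * h by rewrite mulr_ge0.
  have le0 : n%:R * h <= t0 by lra.
  rewrite (le_trans (nrm_trans (T (n%:R * h) g) _ _)) // mulrDl mul1r [leRHS]addrC.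
  rewrite lerD // ?IH // sgD // -(linopB _ _ (sg_linear n0)).
  by apply: HM; rewrite n0.
apply/ler_addgt0Pr => e e0.
have c0 : 0 < t * M by rewrite mulr_gt0.
have [r r0 Hr] := generator_atP gy (divr_gt0 e0 c0).
have [n [h0 hr nh]] := small_step tp r0; move: h0 hr nh; set h := t / _ => h0 hr nh.
rewrite -{1}nh (le_trans (step _ _ (ltW h0) _)) ?nh //.
have h1 := Hr h h0 hr.
have h2 : nrm (T h g - g) <= h * (nrm y + e / (t * M)).
  have := nrmD (T h g - g - h%:C *: y) (h%:C *: y).
  by rewrite subrK nrmZ nrm_real gtr0_norm // mulrDr; lra.
have -> : t * M * nrm y + e = n.+1%:R * (M * (h * (nrm y + e / (t * M)))).
  have qE : e / (t * M) * (t * M) = e by rewrite divfK // lt0r_neq0.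
  move: qE; set q := e / _ => qE; transitivity (n.+1%:R * h * (M * (nrm y + q))); last by ring.
  by rewrite nh -qE; ring.
by rewrite ler_pM2l // ler_pM2l.
Qed.

(** The remainder [w] obeys [w(nh + h) = w(nh) + T(nh) w(h) + h (T(nh) y - y)]. The middle terms are
    [o(h)] and disappear in the limit; the last ones are bounded by [semigroup_sub_le] at [y]. *)
Lemma semigroup_sub_linear_le g y y' t : generator_at g y -> generator_at y y' ->
  0 <= t <= t0 -> nrm (T t g - g - t%:C *: y) <= t ^+ 2 * M * nrm y'.
Proof.
move=> gy gy' /andP[]; rewrite le_eqVlt => /orP[/eqP <- _|tp tt0].
  by rewrite sg0 subrr scale0r subrr nrm0 expr0n !mul0r.
pose w h := T h g - g - h%:C *: y.
have alg (a b c d e u : X) : a - u - (d + e) = (b - u - d) + ((a - b - c) + (c - e)).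
  rewrite (addrA (a - b - c)) subrK !addrA [RHS](ACl (4*2*3*6*(1*5))) /= subrr addr0.
  by rewrite opprD addrA.
have step n h : 0 <= h -> n%:R * h <= t ->
    nrm (w (n%:R * h)) <= n%:R * (M * nrm (w h) + h * (t * M * nrm y')).
  move=> hp; elim: n => [_|n IH].
    by rewrite /w mul0r sg0 subrr scale0r subrr nrm0 mul0r.
  rewrite -natr1 !mulrDl !mul1r => ht.
  have n0 : 0 <= n%:R * h by rewrite mulr_ge0.
  have le0 : n%:R * h <= t by lra.
  have nt0 : 0 <= n%:R * h <= t0 by rewrite n0 /= (le_trans le0).
  have -> : w (n%:R * h + h) = w (n%:R * h) + (T (n%:R * h) (w h) + h%:C *: (T (n%:R * h) y - y)).
    rewrite /w sgD // !(linopB _ _ (sg_linear n0)) (linopZ _ _ (sg_linear n0))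
      rmorphD scalerDl scalerBr.
    exact: alg.
  rewrite (le_trans (nrmD _ _)) // lerD ?IH // (le_trans (nrmD _ _)) // lerD //; first exact: HM.
  rewrite nrmZ nrm_real ger0_norm // ler_wpM2l //.
  rewrite (le_trans (semigroup_sub_le gy' nt0)) // ler_wpM2r ?nrm_ge0 // ler_wpM2r // ltW //.
apply/ler_addgt0Pr => e e0.
have c0 : 0 < t * M by rewrite mulr_gt0.
have [r r0 Hr] := generator_atP gy (divr_gt0 e0 c0).
have [n [h0 hr nh]] := small_step tp r0; move: h0 hr nh; set h := t / _ => h0 hr nh.
have := step n.+1 h (ltW h0); rewrite nh => /(_ (lexx _)) /le_trans; apply.
have h1 : nrm (w h) <= h * (e / (t * M)) := Hr h h0 hr.
have -> : t ^+ 2 * M * nrm y' = n.+1%:R * (h * (t * M * nrm y')) by rewrite mulrA nh; ring.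
rewrite mulrDr addrC lerD2l.
apply: (@le_trans _ _ (n.+1%:R * (M * (h * (e / (t * M)))))).
  by rewrite ler_pM2l // ler_pM2l.
have qE : e / (t * M) * (t * M) = e by rewrite divfK // lt0r_neq0.
rewrite le_eqVlt; apply/orP; left; apply/eqP; move: qE; set q := e / _ => qE.
by rewrite -[RHS]qE -[in RHS]nh; ring.
Qed.

End OneSemigroup.

(* Telescoping: [T(nh) - S(nh)] is a sum of [n] terms, each of size [O(h^2)]. *)
Lemma semigroup_eq_on_orbit (T S : R -> X -> X) (M C t : R) (f : X) :
  C0_semigroup T -> (forall s, 0 <= s <= t -> bounded_by M (T s)) ->
  0 <= M -> 0 <= C -> 0 <= t -> S 0 f = f ->
  (forall s h, 0 <= s -> 0 <= h -> S (s + h) f = S s (S h f)) ->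
  (forall s h, 0 <= s <= t -> 0 <= h <= t -> nrm (T h (S s f) - S h (S s f)) <= C * h ^+ 2) ->
  T t f = S t f.
Proof.
move=> hT HM M0 C0; rewrite le_eqVlt => /orP[/eqP <- -> _ _|tp S0f SD H]; first by rewrite (sg0 hT).
(* The start [S (k h) f] is kept general: replacing one factor [T h] by [S h] moves it to
   [S ((k + 1) h) f]. *)
have step n k h : 0 <= h -> (n + k)%:R * h <= t -> h <= t ->
    nrm (T (n%:R * h) (S (k%:R * h) f) - S (n%:R * h) (S (k%:R * h) f)) <=
      n%:R * (M * (C * h ^+ 2)).
  move=> h0; elim: n k => [|n IH] k nkt ht.
    by rewrite !mul0r (sg0 hT) -SD ?mulr_ge0 // add0r subrr nrm0.
  have nh0 : 0 <= n%:R * h by rewrite mulr_ge0.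
  have kh0 : 0 <= k%:R * h by rewrite mulr_ge0.
  have Sk : S h (S (k%:R * h) f) = S (k.+1%:R * h) f by rewrite -SD // -nat1r mulrDl mul1r.
  have -> : S (n.+1%:R * h) (S (k%:R * h) f) = S (n%:R * h) (S (k.+1%:R * h) f).
    rewrite -Sk -!SD ?addr_ge0 ?mulr_ge0 //; congr (S _ f).
    by rewrite -natr1; ring.
  rewrite sg_nat // (le_trans (nrm_trans (T (n%:R * h) (S (k.+1%:R * h) f)) _ _)) //.
  rewrite -[n.+1%:R]natr1 mulrDl mul1r [leRHS]addrC lerD //; last by apply: IH => //;
    rewrite addnS -addSn.
  rewrite -(linopB _ _ (sg_linear hT nh0)) -Sk.
  have le1 : n%:R * h <= t by apply: le_trans nkt; rewrite ler_wpM2r // ler_nat; lia.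
  have le2 : k%:R * h <= t by apply: le_trans nkt; rewrite ler_wpM2r // ler_nat; lia.
  rewrite (le_trans (HM _ _ _)) ?nh0 // ler_wpM2l // H ?kh0 ?h0 //.
apply/eqP; rewrite -subr_eq0; apply/eqP; apply: nrm_le0 => e e0.
have c0 : 0 < t * M * C + 1 by rewrite ltr_wpDl // !mulr_ge0 // ltW.
have r0 : 0 < Num.min t (e / (t * M * C + 1)) by rewrite lt_min tp divr_gt0.
have [n [h0 hr nh]] := small_step tp r0; move: h0 hr nh; set h := t / _ => h0 hr nh.
move: hr; rewrite lt_min => /andP[ht hr].
have := step n.+1 0%N h (ltW h0); rewrite addn0 nh mul0r => /(_ (lexx _) (ltW ht)).
rewrite S0f => /le_trans; apply.
have -> : n.+1%:R * (M * (C * h ^+ 2)) = t * M * C * h by rewrite -nh; ring.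
move: hr; rewrite ltr_pdivlMr //; lra.
Qed.

End Semigroup.

(** * Exponentials in the functional calculus *)

Section Exponential.
Context {R : realType} {X : completeNormedModType R[i]}.
Variable E : set R[i] -> X -> X.
Hypothesis hE : spectral_measure E.
Implicit Types (D : set R[i]) (f g x y : X) (z w : R[i]) (s t h : R).

Definition expc t z : R[i] := cexp (t%:C * z).
Definition expc_on D t z : R[i] := \1_D z * expc t z.

Lemma Re_realM t z : complex.Re (t%:C * z) = t * complex.Re z.
Proof. by case: z => a b /=; rewrite mul0r subr0. Qed.

Lemma expcD s t z : expc (s + t) z = expc s z * expc t z.
Proof. by rewrite /expc rmorphD mulrDl cexpD. Qed.

Lemma expc0 z : expc 0 z = 1.
Proof. by rewrite /expc mul0r cexp0. Qed.

Lemma nrm_expc t z : nrm (expc t z) = expR (t * complex.Re z).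
Proof. by rewrite nrm_cexp Re_realM. Qed.

Lemma continuous_expc t : continuous (expc t : R[i]^o -> R[i]^o).
Proof.
move=> z; apply: (@continuous_comp R[i]^o R[i]^o R[i]^o (fun z => t%:C * z) cexp);
  last exact: cexp_continuous.
apply/(@cvg_at_nrmP _ R[i]^o R[i]^o) => e e0.
have t1 : 0 < `|t| + 1 by rewrite ltr_wpDl.
exists (e / (`|t| + 1)) => [|w]; first by rewrite divr_gt0.
rewrite ltr_pdivlMr // -mulrBr nrmM nrm_real mulrC => /(le_lt_trans _); apply.
by rewrite ler_wpM2r ?nrm_ge0 // lerDl.
Qed.

Lemma expc_sub1z_le h z :
  nrm (expc h z - 1 - h%:C * z) <= 4 * (h ^+ 2 * nrm z ^+ 2) * (1 + expR (h * complex.Re z)).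
Proof.
have := cexp_sub1z_le (h%:C * z); rewrite nrmM nrm_real Re_realM exprMn real_normK //.
exact: num_real.
Qed.

Section HalfPlane.
Variables (D : set R[i]) (omega : R).
Hypothesis bD : borel D.
Hypothesis Dw : forall z, D z -> complex.Re z <= omega.

Lemma nrm_expc_le t z : 0 <= t -> D z -> nrm (expc t z) <= expR (t * omega).
Proof. by move=> t0 Dz; rewrite nrm_expc ler_expR ler_wpM2l // Dw. Qed.

Lemma nrm_expc_on_le t z : 0 <= t -> nrm (expc_on D t z) <= expR (t * omega).
Proof.
move=> t0; rewrite nrmM indicE; have [/set_mem Dz|_] := boolP (_ \in _).
  by rewrite nrm1 mul1r nrm_expc_le.
by rewrite nrm0 mul0r expR_ge0.
Qed.

Lemma simple_limit_expc_on t : 0 <= t -> simple_limit (expc_on D t).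
Proof.
move=> t0; apply: (@simple_limit_continuous _ setT _ (expc t) (expR (t * omega))) => //.
- exact: openT.
- by move=> z _; exact: continuous_expc.
- by move=> z Dz; exact: nrm_expc_le.
Qed.

Lemma expc_onD s t z : expc_on D (s + t) z = expc_on D s z * expc_on D t z.
Proof. by rewrite /expc_on expcD indicE; case: (_ \in _); rewrite ?mul0r // !mul1r. Qed.

Lemma bint_expcD s t f : 0 <= s -> 0 <= t ->
  bint E (expc_on D (s + t)) f = bint E (expc_on D s) (bint E (expc_on D t) f).
Proof.
move=> s0 t0; rewrite -(bintM hE) ?simple_limit_expc_on //; last exact: simple_limit_expc_on.
  by congr (bint _ _ _); apply/funext => z; exact: expc_onD.
exact: simple_limit_expc_on.
Qed.

Lemma bint_expc0 f : bint E (expc_on D 0) f = E D f.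
Proof.
rewrite -(bint_indic hE) //; congr (bint _ _ _); apply/funext => z.
by rewrite /expc_on expc0 mulr1.
Qed.

Lemma E_bint_expc t f : 0 <= t -> E D (bint E (expc_on D t) f) = bint E (expc_on D t) f.
Proof. by move=> t0; rewrite -bint_expc0 -bint_expcD // add0r. Qed.

End HalfPlane.

Section Bounded.
Variables (D : set R[i]) (rho : R).
Hypothesis bD : borel D.
Hypothesis Dr : forall z, D z -> nrm z <= rho.

Lemma Re_le_rho z : D z -> complex.Re z <= rho.
Proof. by move=> Dz; rewrite (le_trans (ler_norm _)) // (le_trans (Re_le_nrm _)) // Dr. Qed.

Lemma simple_limit_id_on : simple_limit (id_on D).
Proof.
by apply: (@simple_limit_continuous _ setT _ id rho) => //; first exact: openT.
Qed.

Lemma E_bint_id g : E D (bint E (id_on D) g) = bint E (id_on D) g.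
Proof.
rewrite -(bint_indicM hE) //; last exact: simple_limit_id_on.
congr (bint _ _ _); apply/funext => z; rewrite /id_on mulrA indicE.
by case: (_ \in _); rewrite ?mul0r // !mul1r.
Qed.

Lemma bint_expc_taylor (t0 : R) : exists2 C : R, 0 <= C & forall h g, E D g = g -> 0 <= h <= t0 ->
  nrm (bint E (expc_on D h) g - g - h%:C *: bint E (id_on D) g) <= C * h ^+ 2 * nrm g.
Proof.
have [K K0 HK] := bint_bound hE.
exists (K * (4 * rho ^+ 2 * (1 + expR (t0 * `|rho|)))).
  have := expR_gt0 (t0 * `|rho|); have := sqr_ge0 rho => h1 h2.
  by apply: mulr_ge0; [exact: ltW|apply: mulr_ge0; [exact: mulr_ge0|lra]].
move=> h g Eg /andP[h0 ht].
have l1 := simple_limit_expc_on bD Re_le_rho h0; have l2 := simple_limit_indic bD.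
have l3 := simple_limitZ h%:C simple_limit_id_on; have l4 := simple_limitB l1 l2.
rewrite -[X in _ - X - _]Eg -(bint_indic hE _ bD) -(bintZ hE) //; last exact: simple_limit_id_on.
rewrite -!(bintB hE) //.
have -> : K * (4 * rho ^+ 2 * (1 + expR (t0 * `|rho|))) * h ^+ 2 =
  K * (4 * (h * rho) ^+ 2 * (1 + expR (t0 * `|rho|))) by ring.
apply: HK => [|z]; first exact: simple_limitB.
rewrite /expc_on /id_on indicE; have [/set_mem Dz|_] := boolP (_ \in _); last first.
  rewrite !mul0r mulr0 !subr0 nrm0; have := expR_gt0 (t0 * `|rho|); have := sqr_ge0 (h * rho)
    => h1 h2.
  by apply: mulr_ge0; [exact: mulr_ge0|lra].
rewrite !mul1r (le_trans (expc_sub1z_le h z)) // -exprMn ler_pM //.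
- by apply: mulr_ge0 => //; exact: sqr_ge0.
- rewrite ler_pM2l // ler_sqr ?nnegrE ?mulr_ge0 ?nrm_ge0 //; first by rewrite ler_wpM2l // Dr.
  by rewrite (le_trans (nrm_ge0 z)) // Dr.
rewrite lerD2l ler_expR (le_trans (ler_norm _)) // normrM ger0_norm // ler_pM //.
by rewrite (le_trans (Re_le_nrm z)) // (le_trans (Dr Dz)) // ler_norm.
Qed.

(** Both [T h] and the integral of [e^(hz)] agree with [1 + h L] up to [O(h^2)], where [L]
    integrates the identity over [D]. As [L] maps the range of [E D] into itself, the generator
    applies twice there. [G] bounds the orbit up to time [t], which makes the constant uniform. *)
Lemma semigroup_exponential (T : R -> X -> X) t f : C0_semigroup T ->
  (forall g, E D g = g -> generator_at T g (bint E (id_on D) g)) ->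
  0 <= t -> E D f = f -> T t f = bint E (expc_on D t) f.
Proof.
move=> hT hgen t0 Ef.
have [M M1 HM] := sg_locally_bounded hT t.
have M0 : 0 <= M by lra.
have [C C0 HC] := bint_expc_taylor t.
have [K K0 HK] := bint_bound hE.
have [L L0 HL] := bounded_op_bound (bint_bounded hE simple_limit_id_on).
pose G := K * expR (t * `|rho|) * nrm f.
have G0 : 0 <= G by rewrite !mulr_ge0 ?expR_ge0 ?nrm_ge0 ?(ltW K0).
apply: (@semigroup_eq_on_orbit _ _ _ (fun s => bint E (expc_on D s)) M ((M * L ^+ 2 + C) * G))
  => //.
- by rewrite mulr_ge0 // addr_ge0 // mulr_ge0 // sqr_ge0.
- by rewrite (bint_expc0 bD).
- by move=> s h s0 h0; rewrite (bint_expcD bD Re_le_rho).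
move=> s h /andP[s0 st] /andP[h0 ht].
set g := bint E (expc_on D s) f.
have Eg : E D g = g by rewrite (E_bint_expc bD Re_le_rho).
have gG : nrm g <= G.
  apply: HK; first exact: (simple_limit_expc_on bD Re_le_rho).
  move=> z; rewrite (le_trans (nrm_expc_on_le Re_le_rho _ s0)) //.
  by rewrite ler_expR (le_trans (ler_norm _)) // normrM ger0_norm // ler_wpM2r.
set Lg := bint E (id_on D) g.
have h1 : nrm (T h g - g - h%:C *: Lg) <= h ^+ 2 * M * nrm (bint E (id_on D) Lg).
  apply: (semigroup_sub_linear_le hT M1 HM); rewrite ?h0 //; apply: hgen => //.
  exact: E_bint_id.
have h2 : nrm (bint E (expc_on D h) g - g - h%:C *: Lg) <= C * h ^+ 2 * nrm g.
  by apply: HC; rewrite // h0.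
have h3 : nrm (bint E (id_on D) Lg) <= L ^+ 2 * nrm g.
  by rewrite (le_trans (HL _)) // expr2 -mulrA ler_pM2l // HL.
have := nrmB (T h g - g - h%:C *: Lg) (bint E (expc_on D h) g - g - h%:C *: Lg).
have -> : T h g - g - h%:C *: Lg - (bint E (expc_on D h) g - g - h%:C *: Lg)
  = T h g - bint E (expc_on D h) g.
  by rewrite -!(addrA _ (- g)) opprD addrACA subrr addr0.
have hM : 0 <= h ^+ 2 * M by rewrite mulr_ge0 // sqr_ge0.
have h4 : h ^+ 2 * M * nrm (bint E (id_on D) Lg) <= h ^+ 2 * M * (L ^+ 2 * G).
  by rewrite ler_wpM2l // (le_trans h3) // ler_wpM2l // sqr_ge0.
have h5 : C * h ^+ 2 * nrm g <= C * h ^+ 2 * G by rewrite ler_wpM2l // mulr_ge0 // sqr_ge0.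
lra.
Qed.

End Bounded.
End Exponential.

(** * The spectrum of a generator *)

Lemma log_regionP {R : realType} (omega a b : R) (z : R[i]) : 0 < b ->
  log_region omega a b z <-> complex.Re z <= omega /\
    (complex.Im z != 0 -> complex.Re z <= a - b * ln `|complex.Im z|).
Proof.
move=> b0; rewrite /log_region /mkset le_min lee_fin.
have [->|i0] := eqVneq (complex.Im z) 0.
  rewrite normr0 le0_lneNy ?lexx // gt0_muleNy ?lte_fin // /= leey andbT.
  by split=> [h|[]//]; split.
have i1 : 0 < `|complex.Im z| by rewrite normr_gt0.
rewrite lne_EFin // -EFinM -EFinN -EFinD lee_fin.
split=> [/andP[-> h]|[-> h]] //=; exact: h.
Qed.

Lemma nrm_cvg_le {R : realType} {X : normedModType R[i]} (u v : nat -> X) x y (c : R) N :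
  0 <= c -> u @ \oo --> x -> v @ \oo --> y ->
  (forall n, (N <= n)%N -> nrm (u n) <= c * nrm (v n)) -> nrm x <= c * nrm y.
Proof.
move=> c0 /cvg_seqP ux /cvg_seqP vy H; apply/ler_addgt0Pr => e e0.
have e2 : 0 < e / (1 + c) by rewrite divr_gt0 //; lra.
have [N1 H1] := ux _ e2; have [N2 H2] := vy _ e2.
pose n := (N + (N1 + N2))%N.
have := H n (leq_addr _ _); have := H1 n; have := H2 n.
rewrite /n; move=> /(_ ltac:(lia)) h2 /(_ ltac:(lia)) h1 h.
have qE : e / (1 + c) * (1 + c) = e by rewrite divfK // lt0r_neq0 //; lra.
move: e2 h1 h2 qE; set q := e / _ => e2 h1 h2 qE.
have := nrmBl x (u (N + (N1 + N2))%N); rewrite nrmBC => h3.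
have := nrmBl (v (N + (N1 + N2))%N) y => h4.
have h5 : c * nrm (v (N + (N1 + N2))%N) <= c * (nrm y + q) by rewrite ler_wpM2l //; lra.
lra.
Qed.

Section SpectralOperator.
Context {R : realType} {X : completeNormedModType R[i]}.
Variables (A : operator X) (E : set R[i] -> X -> X).
Hypothesis hE : spectral_measure E.
Hypothesis suppE : Defs.support E = spectrum A.
Hypothesis AE : forall f y, (dom A f /\ A f = y) <-> is_spectral_integral E (spectrum A) id f y.
Implicit Types (D : set R[i]) (f g x y : X) (z w : R[i]) (s t h : R).

Let sigma := spectrum A.
Let sigman (n : nat) := sigma `&` [set w | nrm w <= n%:R].

Lemma borel_sigma : borel sigma.
Proof. by rewrite /sigma -suppE; exact: borel_support. Qed.

Lemma E_sigma f : E sigma f = f.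
Proof. by rewrite /sigma -suppE (E_support hE). Qed.

Lemma borel_sigman n : borel (sigman n).
Proof. by apply: borelI; [exact: borel_sigma|exact: borel_nrm_le]. Qed.

Lemma sigman_le n z : sigman n z -> nrm z <= n%:R.
Proof. by case. Qed.

Lemma subset_sigman m n : (m <= n)%N -> sigman m `<=` sigman n.
Proof. by move=> mn z [sz zm]; split => //=; rewrite (le_trans zm) // ler_nat. Qed.

Lemma E_sigman_cvg f : E (sigman n) f @[n --> \oo] --> f.
Proof.
have sU : \bigcup_n sigman n = sigma.
  apply/seteqP; split=> [z [n _ []] //|z sz]; exists (Num.bound (nrm z)) => //; split => //=.
  by rewrite ltW // archi_boundP // nrm_ge0.
rewrite -[X in _ --> X]E_sigma -sU.
apply: (E_nondecreasing hE); first exact: borel_sigman.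
by move=> m n mn; apply/subsetPset; exact: subset_sigman.
Qed.

Lemma generates_spectral (T : R -> X -> X) : generates A T <->
  forall f y, generator_at T f y <-> bint E (trunc_id sigma n) f @[n --> \oo] --> y.
Proof.
have sp f y : (dom A f /\ A f = y) <-> bint E (trunc_id sigma n) f @[n --> \oo] --> y.
  by rewrite AE; exact: (spectral_integral_idP hE _ _ borel_sigma).
split=> H f y.
  by rewrite -sp; split=> /(H f y).
by rewrite sp; split=> /(H f y).
Qed.

Lemma trunc_id_cvg D (rho : R) g : borel D -> D `<=` sigma -> (forall z, D z -> nrm z <= rho) ->
  E D g = g -> bint E (trunc_id sigma n) g @[n --> \oo] --> bint E (id_on D) g.
Proof.
move=> bD Ds Dr Eg; apply/cvg_seqP => e e0; exists (Num.bound `|rho|) => n Nn.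
rewrite -{1}Eg -(bint_Mindic hE) //; last by apply: simple_limit_trunc_id; exact: borel_sigma.
have -> : (fun z => \1_D z * trunc_id sigma n z) = id_on D.
  apply/funext => z; rewrite /trunc_id /id_on indicE.
  have [/set_mem Dz|_] := boolP (_ \in _); last by rewrite !mul0r.
  rewrite !mul1r indic_in ?mul1r //; split; first exact: Ds.
  rewrite /= (le_trans (Dr z Dz)) // (le_trans (ler_norm _)) //.
  by rewrite (le_trans (ltW (archi_boundP (normr_ge0 rho)))) // ler_nat.
by rewrite subrr nrm0.
Qed.

Lemma semigroup_on_bounded (T : R -> X -> X) D (rho : R) t g : C0_semigroup T -> generates A T ->
  borel D -> D `<=` sigma -> (forall z, D z -> nrm z <= rho) -> 0 <= t -> E D g = g ->
  T t g = bint E (expc_on D t) g.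
Proof.
move=> hT /generates_spectral hgen bD Ds Dr t0 Eg.
apply: (semigroup_exponential hE bD Dr) => // g' Eg'.
by apply/hgen; exact: (trunc_id_cvg bD Ds Dr Eg').
Qed.

(** One vector serves two times, because a difference quotient compares [T(t + h)] and [T(t)] at the
    same vector. *)
Lemma approximate_eigenvector (T : R -> X -> X) z t1 t2 (e : R) :
  C0_semigroup T -> generates A T -> sigma z -> 0 <= t1 -> 0 <= t2 -> 0 < e ->
  exists x, [/\ 0 < nrm x, nrm (T t1 x - expc t1 z *: x) <= e * nrm x &
    nrm (T t2 x - expc t2 z *: x) <= e * nrm x].
Proof.
move=> hT hgen sz t10 t20 e0.
have [K K0 HK] := bint_near_scalar hE.
have eK : 0 < e / K by rewrite divr_gt0.
have /(@cvg_at_nrmP _ R[i]^o R[i]^o)/(_ _ eK)[d1 d10 H1] := @continuous_expc R t1 z.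
have /(@cvg_at_nrmP _ R[i]^o R[i]^o)/(_ _ eK)[d2 d20 H2] := @continuous_expc R t2 z.
pose d := Num.min d1 d2.
have d0 : 0 < d by rewrite lt_min d10.
have zz : cball z d z by rewrite /cball /= subrr nrm0.
have [f fx] : exists f, E (cball z d) f <> 0.
  by move: sz; rewrite /sigma -suppE => /(_ _ (@open_cball _ z d) zz).
pose D := cball z d `&` sigma.
have bD : borel D by apply: borelI; [exact: borel_cball|exact: borel_sigma].
have Dr w : D w -> nrm w <= nrm z + d.
  by case=> wz _; have := nrmBl w z; move: wz; rewrite /cball /=; lra.
have Ds : D `<=` sigma by move=> w [].
have Ex : E D (E (cball z d) f) = E (cball z d) f.
  rewrite (E_setI hE) ?E_sigma -?(E_setI hE) ?setIid //;
  first [exact: borel_cball|exact: borel_sigma].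
exists (E (cball z d) f); split; first by rewrite nrm_gt0; apply/eqP.
- rewrite (semigroup_on_bounded hT hgen bD Ds Dr) //.
  rewrite -(divfK (lt0r_neq0 K0) e) (mulrC (e / K)).
  apply: (HK _ _ _ _ _ bD (simple_limit_expc_on bD (Re_le_rho Dr) t10) Ex (ltW eK)).
  move=> w Dw; rewrite /expc_on indic_in // mul1r ltW // H1 //.
  by case: Dw; rewrite /cball /= lt_min => /andP[].
- rewrite (semigroup_on_bounded hT hgen bD Ds Dr) //.
  rewrite -(divfK (lt0r_neq0 K0) e) (mulrC (e / K)).
  apply: (HK _ _ _ _ _ bD (simple_limit_expc_on bD (Re_le_rho Dr) t20) Ex (ltW eK)).
  move=> w Dw; rewrite /expc_on indic_in // mul1r ltW // H2 //.
  by case: Dw; rewrite /cball /= lt_min => /andP[].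
Qed.

Lemma spectrum_Re_bounded (T : R -> X -> X) : C0_semigroup T -> generates A T ->
  exists omega : R, forall z, sigma z -> complex.Re z <= omega.
Proof.
move=> hT hgen; have [M M0 HM] := bounded_op_bound (sg_bounded hT ler01).
exists (ln M) => z sz; rewrite -[leLHS]expRK ler_ln ?posrE ?expR_gt0 //.
apply/ler_addgt0Pr => e e0.
have [x [x0 Hx _]] := approximate_eigenvector hT hgen sz ler01 ler01 e0.
rewrite -(ler_pM2r x0) -[complex.Re z]mul1r -nrm_expc -nrmZ.
have := HM x; have := nrmBl (expc 1 z *: x) (T 1 x); rewrite nrmBC; lra.
Qed.

Lemma spectrum_growth_bounded (T : R -> X -> X) t : C0_semigroup T -> generates A T ->
  immediately_differentiable T -> 0 < t ->
  exists2 C : R, 0 < C & forall z, sigma z -> nrm z * expR (t * complex.Re z) <= C.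
Proof.
move=> hT hgen dT t0.
have [r [r0 rlim]] := @null_sequence R.
have tr0 n : 0 <= t + r n by rewrite addr_ge0 // ltW.
pose F n x := ((r n)^-1)%:C *: (T (t + r n) x - T t x).
have [||C C0 HC] := @uniform_boundedness R X nat F.
- move=> n; have [M M0 HM] := bounded_op_bound (sg_bounded hT (tr0 n)).
  have [M' M'0 HM'] := bounded_op_bound (sg_bounded hT (ltW t0)).
  apply: (@bounded_by_op _ _ ((r n)^-1 * (M + M'))).
    move=> c x y; rewrite /F (sg_linear hT (tr0 n)) (sg_linear hT (ltW t0)).
    by rewrite opprD addrACA -scalerBr scalerDr !scalerA mulrC.
  move=> x; rewrite /F nrmZ nrm_real ger0_norm ?invr_ge0 ?(ltW (r0 n)) // -mulrA.
  rewrite ler_wpM2l ?invr_ge0 ?(ltW (r0 n)) // (le_trans (nrmB _ _)) // mulrDl.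
  by rewrite lerD ?HM ?HM'.
- move=> x; have /cvg_ex[y /cvg0punctP/(_ _ ltr01)[d d0 Hd]] := dT x t t0.
  have [N HN] := rlim d d0; apply: (@bounded_of_eventually _ _ (nrm y + 1) N) => n Nn.
  have := Hd (r n); rewrite gt_eqF // gtr0_norm // => /(_ isT (HN n Nn)).
  have := nrmBl (F n x) y; rewrite /F; lra.
exists C => // z sz.
(* The uniform bound on the difference quotients passes to the scalars [e^(tz)] through an
   approximate eigenvector, up to an arbitrary [e]. *)
have growth n : nrm (expc (t + r n) z - expc t z) <= C * r n.
  apply/ler_addgt0Pr => e e0; have e2 : 0 < e / 2 by rewrite divr_gt0.
  have [x [x0 H1 H2]] := approximate_eigenvector hT hgen sz (tr0 n) (ltW t0) e2.
  rewrite -(ler_pM2r x0) -nrmZ scalerBl.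
  have h1 : nrm (T (t + r n) x - T t x) <= C * r n * nrm x.
    have := HC n x; rewrite /F nrmZ nrm_real ger0_norm ?invr_ge0 ?(ltW (r0 n)) //.
    by rewrite ler_pdivrMl // mulrCA mulrA.
  have := nrm_trans (T (t + r n) x) (expc (t + r n) z *: x) (expc t z *: x).
  have := nrm_trans (T t x) (T (t + r n) x) (expc t z *: x).
  rewrite (nrmBC (expc (t + r n) z *: x) (T (t + r n) x)); lra.
pose q := expR (t * complex.Re z).
have q0 : 0 < q := expR_gt0 _.
(* For [0 < h < 1] the remainder [e^(tz) (e^(hz) - 1 - hz)] is at most [h^2 c], so
   [|z| e^(t Re z) <= C + h c]. Here [z] is fixed, so [c] may depend on it. *)
pose c := q * (4 * nrm z ^+ 2 * (1 + expR (nrm z))).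
have c0 : 0 <= c.
  have := expR_gt0 (nrm z); have := sqr_ge0 (nrm z) => h h'.
  by apply: mulr_ge0; [exact: ltW|apply: mulr_ge0; [exact: mulr_ge0|lra]].
apply/ler_addgt0Pr => e e0.
have m0 : 0 < Num.min 1 (e / (c + 1)) by rewrite lt_min ltr01 divr_gt0 // ltr_wpDl.
have [N /(_ N (leqnn N))] := rlim _ m0; rewrite lt_min => /andP[r1].
rewrite ltr_pdivlMr ?ltr_wpDl // => rc.
have := growth N; have rN := r0 N; move: rN r1 rc; move: (r N) => h h0 h1 hc.
have -> : expc (t + h) z - expc t z = expc t z * (expc h z - 1) by rewrite expcD mulrBr mulr1.
rewrite nrmM nrm_expc -/q => h2.
have h3 := expc_sub1z_le h z.
have h4 : nrm (h%:C * z) = h * nrm z by rewrite nrmM nrm_real gtr0_norm.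
have h5 : nrm (h%:C * z) <= nrm (expc h z - 1) + nrm (expc h z - 1 - h%:C * z).
  by have := nrmBl (h%:C * z) (expc h z - 1); rewrite nrmBC; lra.
have h6 : expR (h * complex.Re z) <= expR (nrm z).
  rewrite ler_expR (le_trans (ler_norm _)) // normrM gtr0_norm //.
  rewrite (le_trans (ler_wpM2l (ltW h0) (Re_le_nrm z))) //.
  by rewrite ler_piMl ?nrm_ge0 // ltW.
have h7 : q * nrm (expc h z - 1 - h%:C * z) <= h ^+ 2 * c.
  have -> : h ^+ 2 * c = q * (4 * (h ^+ 2 * nrm z ^+ 2) * (1 + expR (nrm z))) by rewrite /c; ring.
  rewrite ler_pM2l // (le_trans h3) // ler_wpM2l ?lerD2l //.
  by rewrite mulr_ge0 // mulr_ge0 // sqr_ge0.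
have h8 : q * (h * nrm z) <= C * h + h ^+ 2 * c.
  rewrite -h4; move: h5; rewrite -(ler_pM2l q0); lra.
rewrite -(ler_pM2l h0).
have h9 : h * (h * (c + 1)) <= h * e by rewrite ler_pM2l // ltW.
by have := sqr_ge0 h; nra.
Qed.

Lemma spectrum_in_log_region (T : R -> X -> X) : C0_semigroup T -> generates A T ->
  immediately_differentiable T ->
  exists omega : R, forall b : R, 0 < b -> exists a : R, spectrum A `<=` log_region omega a b.
Proof.
move=> hT hgen dT; have [omega Hw] := spectrum_Re_bounded hT hgen.
exists omega => b b0; have bi : 0 < b^-1 by rewrite invr_gt0.
have [C C0 HC] := spectrum_growth_bounded hT hgen dT bi.
exists (b * ln C) => z sz; apply/log_regionP => //; split; first exact: Hw.
move=> i0; have i1 : 0 < `|complex.Im z| by rewrite normr_gt0.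
have : `|complex.Im z| * expR (b^-1 * complex.Re z) <= C.
  by rewrite (le_trans _ (HC z sz)) // ler_wpM2r ?expR_ge0 // Im_le_nrm.
have e0 := expR_gt0 (b^-1 * complex.Re z).
move=> h; have : ln (`|complex.Im z| * expR (b^-1 * complex.Re z)) <= ln C.
  by rewrite ler_ln ?posrE // mulr_gt0.
rewrite lnM ?posrE // expRK.
rewrite -(ler_pM2l b0) mulrDr mulrA divff ?lt0r_neq0 // mul1r; lra.
Qed.

End SpectralOperator.

(** * The semigroup generated by a spectral operator *)

Section Generation.
Context {R : realType} {X : completeNormedModType R[i]}.
Variables (A : operator X) (E : set R[i] -> X -> X).
Hypothesis hE : spectral_measure E.
Hypothesis suppE : Defs.support E = spectrum A.
Hypothesis AE : forall f y, (dom A f /\ A f = y) <-> is_spectral_integral E (spectrum A) id f y.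
Variable omega : R.
Hypothesis Hw : forall z, spectrum A z -> complex.Re z <= omega.
Implicit Types (D : set R[i]) (f g x y : X) (z w : R[i]) (s t h : R).

Let sigma := spectrum A.
Let sigman (n : nat) := sigma `&` [set w | nrm w <= n%:R].
Let bs : borel sigma := borel_sigma hE suppE.
Let bsn n : borel (sigman n) := borel_sigman hE suppE n.
Let Es f : E sigma f = f := E_sigma hE suppE f.
Let Dn n z (h : sigman n z) : nrm z <= n%:R := @sigman_le R X A n z h.
Let Esn f : E (sigman n) f @[n --> \oo] --> f := @E_sigman_cvg R X A E hE suppE f.

Definition exp_semigroup t := bint E (expc_on sigma t).
Local Notation T := exp_semigroup.
Let L n := bint E (id_on (sigman n)).

Let lexp t : 0 <= t -> simple_limit (expc_on sigma t) := simple_limit_expc_on bs Hw (t:=t).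
Let lid n : simple_limit (id_on (sigman n)) := simple_limit_id_on (bsn n) (@Dn n).

Lemma E_sigmanI m n f : (m <= n)%N -> E (sigman n) (E (sigman m) f) = E (sigman m) f.
Proof.
move=> mn; rewrite -(E_setI hE) //; congr (E _ _); apply/setIidPr.
exact: subset_sigman.
Qed.

Lemma exp_semigroup_sigman n t g : 0 <= t -> E (sigman n) g = g ->
  T t g = bint E (expc_on (sigman n) t) g.
Proof.
move=> t0 Eg; rewrite -{1}Eg /T -(bint_Mindic hE) //; last exact: lexp.
congr (bint _ _ _); apply/funext => z; rewrite /expc_on mulrA indicE.
have [/set_mem zs|_] := boolP (_ \in _); last by rewrite !mul0r.
by rewrite !mul1r indic_in ?mul1r //; case: zs.
Qed.

Lemma exp_semigroup_generator_at n g : E (sigman n) g = g -> generator_at T g (L n g).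
Proof.
move=> Eg; have [C C0 HC] := bint_expc_taylor hE (bsn n) (@Dn n) 1.
apply/cvg0rightP => e e0.
have c0 : 0 < C * nrm g + 1 by rewrite ltr_wpDl // mulr_ge0 ?nrm_ge0.
exists (Num.min 1 (e / (C * nrm g + 1))); first by rewrite lt_min ltr01 divr_gt0.
move=> t t0; rewrite lt_min ltr_pdivlMr // => /andP[t1 te].
have := HC t g Eg; rewrite (ltW t0) (ltW t1) -exp_semigroup_sigman ?(ltW t0) // => /(_ isT) h.
rewrite -(ltr_pM2l t0).
have -> : t * nrm ((t^-1)%:C *: (T t g - g) - L n g) = nrm (t%:C *: ((t^-1)%:C *: (T t g - g)
  - L n g)).
  by rewrite nrmZ nrm_real gtr0_norm.
rewrite scalerBr scaleRK ?lt0r_neq0 // (le_lt_trans h) // expr2.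
have : t * (t * (C * nrm g + 1)) < t * e by rewrite ltr_pM2l.
by have := mulr_gt0 t0 t0; nra.
Qed.

Lemma exp_semigroup_bounded_on (t0 : R) : exists2 M : R, 1 <= M &
  forall t, 0 <= t <= t0 -> bounded_by M (T t).
Proof.
have [K K0 HK] := bint_bound hE.
exists (1 + K * expR (t0 * `|omega|)).
  by rewrite lerDl mulr_ge0 ?expR_ge0 ?(ltW K0).
move=> t /andP[tp tt] f.
have h : nrm (T t f) <= K * expR (t0 * `|omega|) * nrm f.
  apply: HK => [|z]; first exact: lexp.
  rewrite (le_trans (nrm_expc_on_le Hw z tp)) // ler_expR (le_trans (ler_norm _)) //.
  by rewrite normrM ger0_norm // ler_wpM2r.
by rewrite (le_trans h) // ler_wpM2r ?nrm_ge0 // lerDr.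
Qed.

Lemma exp_semigroup_C0 : C0_semigroup T.
Proof.
split.
- by move=> t t0; apply: (bint_bounded hE); exact: lexp.
- by move=> f; rewrite /T (bint_expc0 hE bs) Es.
- by move=> s t s0 t0 f; rewrite /T (bint_expcD hE bs Hw).
move=> f; apply/cvg0rightP => e e0.
have [M M1 HM] := exp_semigroup_bounded_on 1.
have M0 : 0 < M + 2 by lra.
(* Replacing [f] by its truncation [g] costs [M + 1] times [nrm (g - f)]; dividing by [M + 2] leaves
   a positive margin for [T t g - g], which is small because [g] lies in the domain of the
   generator. *)
have [N /(_ N (leqnn N)) HN] := (cvg_seqP _ _).1 (@Esn f) _ (divr_gt0 e0 M0).
move: HN; set g := E (sigman N) f; rewrite ltr_pdivlMr // => HN.
have Eg : E (sigman N) g = g by rewrite /g E_sigmanI.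
have e1 : 0 < e - nrm (g - f) * (M + 1).
  by have := nrm_ge0 (g - f); lra.
have [r r0 Hr] := (@cvg0rightP _ _ _ _).1 (exp_semigroup_generator_at Eg) _ ltr01.
have l0 : 0 < nrm (L N g) + 1 by rewrite ltr_wpDl ?nrm_ge0.
exists (Num.min (Num.min 1 r) ((e - nrm (g - f) * (M + 1)) / (nrm (L N g) + 1))).
  by rewrite !lt_min ltr01 r0 divr_gt0.
move=> t t0; rewrite !lt_min ltr_pdivlMr // => /andP[/andP[t1 tr] te].
have lT : linear (T t) by apply: (bint_linear hE); exact/lexp/ltW.
have h1 : nrm (T t g - g) <= t * (nrm (L N g) + 1).
  have := Hr t t0 tr; have := nrmBl ((t^-1)%:C *: (T t g - g)) (L N g).
  rewrite nrmZ nrm_real ger0_norm ?invr_ge0 ?(ltW t0) // => h2 h3.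
  by rewrite -ler_pdivrMl //; lra.
have h2 : nrm (T t (f - g)) <= M * nrm (g - f).
  by rewrite (nrmBC g f); apply: HM; rewrite !ltW.
have -> : T t f - f = T t (f - g) + (T t g - g) + (g - f).
  by rewrite (linopB _ _ lT) !addrA !subrK.
have := nrmD (T t (f - g) + (T t g - g)) (g - f).
have := nrmD (T t (f - g)) (T t g - g); lra.
Qed.

(** If the quotients at [f] tend to [y], applying [E (sigman n)], which commutes with [T t], gives
    [L n f = E (sigman n) y], which tends to [y]. Conversely, [f] is split into a truncation, where
    the generator is known, and a tail whose quotient must be small uniformly in [t]. *)
Lemma exp_semigroup_generates : generates A T.
Proof.
apply/(generates_spectral hE suppE AE) => f y; split=> H.
- have Ly n : L n f = E (sigman n) y.
    have bE := E_bounded hE (bsn n).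
    have h1 : generator_at T (E (sigman n) f) (E (sigman n) y).
      have h := (@cvg0rightP _ _ _ _).1 (bounded_op_cvg bE H).
      apply/cvg0rightP => e /h [r r0 Hr]; exists r => // t t0 tr.
      have := Hr t t0 tr; rewrite (linopZ _ _ bE.1) (linopB _ _ bE.1).
      have -> : E (sigman n) (T t f) = T t (E (sigman n) f).
        rewrite /T -!(bint_indic hE) // (bint_commute hE) //; last exact/lexp/ltW.
        exact: simple_limit_indic.
      by [].
    have h2 := exp_semigroup_generator_at (E_sigmanI f (leqnn n)).
    have -> : L n f = L n (E (sigman n) f).
      rewrite /L -(bint_Mindic hE) //; congr (bint _ _ _); apply/funext => z.
      by rewrite /id_on mulrA indicE; case: (_ \in _); rewrite ?mul0r // !mul1r.
    exact: (cvg_unique _ h2 h1).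
  by rewrite (_ : (fun n => _) = (fun n => E (sigman n) y)) //; apply/funext => n; exact: Ly.
have LE m n : (m <= n)%N -> L n (E (sigman m) f) = L m f.
  move=> mn; rewrite /L -(bint_Mindic hE) //; congr (bint _ _ _); apply/funext => z.
  rewrite /id_on indicE.
  have [/set_mem zm|_] := boolP (_ \in _); last by rewrite !mul0r.
  by rewrite !mul1r indic_in ?mul1r //; exact: subset_sigman zm.
have [M M1 HM] := exp_semigroup_bounded_on 1.
have M0 : 0 < M + 2 by lra.
apply/cvg0rightP => e e0; have e2 : 0 < e / 2 by rewrite divr_gt0.
have [N HN] := (cvg_seqP _ _).1 H _ (divr_gt0 e2 M0).
have {}HN : nrm (L N f - y) < e / 2 / (M + 2) := HN N (leqnn N).
move: HN; rewrite ltr_pdivlMr // => HN.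
set g := E (sigman N) f.
have Eg : E (sigman N) g = g by rewrite /g E_sigmanI.
have [r r0 Hr] := (@cvg0rightP _ _ _ _).1 (exp_semigroup_generator_at Eg) _ e2.
rewrite LE // in Hr.
exists (Num.min 1 r); first by rewrite lt_min ltr01.
move=> t t0; rewrite lt_min => /andP[t1 tr].
have bT : bounded_operator (T t) by apply: (bint_bounded hE); exact/lexp/ltW.
(* The bound is linear in [t], as dividing by [t] requires. It holds for the truncations at level
   [m] by [semigroup_sub_le], with generator value [L m f - L N f], and [m] then tends to
   infinity. *)
have tail : nrm (T t (f - g) - (f - g)) <= t * M * nrm (y - L N f).
  apply: (@nrm_cvg_le _ _ (fun m => T t (E (sigman m) f - g) - (E (sigman m) f - g))
    (fun m => L m f - L N f) _ _ _ N).
  - by rewrite mulr_ge0 ?(ltW t0) //; lra.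
  - have c1 : E (sigman m) f - g @[m --> \oo] --> f - g by apply: cvgB; [exact: Esn|exact: cvg_cst].
    by apply: cvgB => //; exact: bounded_op_cvg bT c1.
  - by apply: cvgB; [exact: H|exact: cvg_cst].
  move=> m Nm.
  apply: (semigroup_sub_le exp_semigroup_C0 M1 HM); last by rewrite (ltW t0) ltW.
  have -> : L m f - L N f = L m (E (sigman m) f - g).
    by rewrite (linopB _ _ (bint_linear hE (lid m) : linear (L m))) !LE.
  apply: exp_semigroup_generator_at.
  by rewrite (linopB _ _ (E_linear hE (bsn m))) !E_sigmanI.
have -> : (t^-1)%:C *: (T t f - f) - y = ((t^-1)%:C *: (T t g - g) - L N f) +
    (t^-1)%:C *: (T t (f - g) - (f - g)) + (L N f - y).
  have -> : T t f - f = (T t g - g) + (T t (f - g) - (f - g)).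
    rewrite (linopB _ _ bT.1); set a := T t f; set b := T t g.
    by rewrite opprB addrACA (addrC b) subrK !addrA subrK.
  by rewrite scalerDr !addrA [RHS](ACl (1*3*(2*4)*5)) /= addNr addr0.
have := nrmD ((t^-1)%:C *: (T t g - g) - L N f + (t^-1)%:C *: (T t (f - g) - (f - g))) (L N f - y).
have := nrmD ((t^-1)%:C *: (T t g - g) - L N f) ((t^-1)%:C *: (T t (f - g) - (f - g))).
rewrite nrmZ nrm_real ger0_norm ?invr_ge0 ?(ltW t0) //.
have : t^-1 * nrm (T t (f - g) - (f - g)) <= M * nrm (y - L N f).
  by rewrite ler_pdivrMl // mulrA.
rewrite (nrmBC y); have := Hr t t0 tr; have := nrm_ge0 (L N f - y); lra.
Qed.

(** For [x < 0] the inequality [u^2 / 2 <= e^u] at [u = - s x] gives [2 / s^2]; for [x >= 0] both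
    factors are largest at [omega]. *)
Lemma sqr_mul_expR_le (s x : R) : 0 < s -> x <= omega ->
  x ^+ 2 * expR (s * x) <= omega ^+ 2 * expR (s * omega) + 2 / s ^+ 2.
Proof.
move=> s0 xw; have s2 : 0 < 2 / s ^+ 2 by rewrite divr_gt0 // exprn_gt0.
have [x0|x0] := leP 0 x.
  rewrite (@le_trans _ _ (omega ^+ 2 * expR (s * omega))) //; last by rewrite lerDl ltW.
  rewrite ler_pM ?sqr_ge0 ?expR_ge0 //; last by rewrite ler_expR ler_pM2l.
  by rewrite ler_sqr ?nnegrE // (le_trans x0).
apply: (@le_trans _ _ (2 / s ^+ 2)); last by rewrite lerDr mulr_ge0 ?sqr_ge0 ?expR_ge0.
have sx : 0 <= s * - x by rewrite mulr_ge0 ?(ltW s0) // oppr_ge0 ltW.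
have := expR_ge1Dxn 1 sx; rewrite mulrN expRN => h.
rewrite ler_pdivlMr ?exprn_gt0 // mulrAC -ler_pdivlMr ?expR_gt0 //.
move: h; set q := (expR _)^-1; rewrite sqrrN exprMn => h.
have : (s ^+ 2 * x ^+ 2) / 2 <= q by move: h; rewrite /factorial /=; lra.
lra.
Qed.

Hypothesis Hlog : forall b : R, 0 < b -> exists a : R, spectrum A `<=` log_region omega a b.

Lemma spectrum_sqr_growth s : 0 < s -> exists2 C : R, 0 < C &
  forall z, sigma z -> nrm z ^+ 2 * expR (s * complex.Re z) <= C.
Proof.
move=> s0; have b0 : 0 < 2 / s by rewrite divr_gt0.
(* With [b = 2 / s] the region says [s Re z + 2 ln |Im z| <= s a], that is
   [|Im z|^2 e^(s Re z) <= e^(s a)]. *)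
have [a Ha] := Hlog b0.
exists (omega ^+ 2 * expR (s * omega) + 2 / s ^+ 2 + expR (s * a)).
  have p2 : 0 < 2 / s ^+ 2 by rewrite divr_gt0 // exprn_gt0.
  have := mulr_ge0 (sqr_ge0 omega) (expR_ge0 (s * omega)); have := expR_gt0 (s * a).
  by move: p2; set q := 2 / _; lra.
move=> z sz; have /(log_regionP _ _ _ b0)[zw zi] := Ha z sz.
rewrite nrm_sqr mulrDl lerD ?sqr_mul_expR_le //.
have [->|i0] := eqVneq (complex.Im z) 0; first by rewrite expr0n mul0r expR_ge0.
have i1 : 0 < `|complex.Im z| by rewrite normr_gt0.
rewrite -(real_normK (num_real (complex.Im z))).
have -> : `|complex.Im z| ^+ 2 = expR (2 * ln `|complex.Im z|).
  by rewrite expRM_natl lnK.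
rewrite -expRD ler_expR.
have := zi i0; rewrite -(ler_pM2l s0) mulrBr => h.
have : s * (2 / s * ln `|complex.Im z|) = 2 * ln `|complex.Im z|.
  by rewrite mulrA (mulrC s) divfK // lt0r_neq0.
lra.
Qed.

Lemma exp_semigroup_differentiable : immediately_differentiable T.
Proof.
move=> f t t0.
(* Half of [t] pays for [|z|^2]. For [|h| < s] the times [t] and [t + h] both exceed what is spent
   by a nonnegative amount, even when [h] is negative. *)
have [s s0 ss] : exists2 s : R, 0 < s & s + s = t by exists (t / 2); lra.
have [C C0 HC] := spectrum_sqr_growth s0.
have [C' C'0 HC'] := spectrum_sqr_growth t0.
pose F z : R[i] := \1_sigma z * (z * expc t z).
have lF : simple_limit F.
  apply: (@simple_limit_continuous _ setT _ (fun z => z * expc t z) (expR (t * omega) + C')) => //.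
  - exact: openT.
  - move=> z _.
    have c1 : (fun w : R[i]^o => w) v @[v --> (z : R[i]^o)] --> (z : R[i]^o) by exact: cvg_id.
    exact: (cvgM c1 (@continuous_expc R t z)).
  move=> z sz; rewrite nrmM nrm_expc.
  have e1 := expR_gt0 (t * complex.Re z).
  have e2 : expR (t * complex.Re z) <= expR (t * omega) by rewrite ler_expR ler_pM2l // Hw.
  have := HC' z sz; have := sqr_ge0 (nrm z - 1); nra.
have [K K0 HK] := bint_bound hE.
(* The constant 4 of [expc_sub1z_le], once for the time [t] and once for [t + h]. *)
pose Q := 8 * C * expR (t * `|omega|).
have Q0 : 0 < Q by rewrite !mulr_gt0 ?expR_gt0.
apply/cvg_ex; exists (bint E F f); apply/cvg0punctP => e e0.
have c0 : 0 < K * Q * nrm f + 1 by rewrite ltr_wpDl // mulr_ge0 ?nrm_ge0 // mulr_ge0 // ltW.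
exists (Num.min s (e / (K * Q * nrm f + 1))); first by rewrite lt_min s0 divr_gt0.
move=> h h0; rewrite lt_min ltr_pdivlMr // => /andP[hs he].
have /andP[hs1 hs2] : - s < h < s by rewrite -ltr_norml.
have th : 0 <= t + h by lra.
have l1 := lexp th; have l2 := lexp (ltW t0).
have l3 := simple_limitB l1 l2; have l4 := simple_limitZ h%:C lF; have l5 := simple_limitB l3 l4.
have -> : (h^-1)%:C *: (T (t + h) f - T t f) - bint E F f =
   (h^-1)%:C *: bint E (fun z => expc_on sigma (t + h) z - expc_on sigma t z - h%:C * F z) f.
  rewrite !(bintB hE) // (bintZ hE) // [RHS]scalerBr scalerA -rmorphM /= mulVf // scale1r.
  by [].
have hn : 0 < `|h| by rewrite normr_gt0.
rewrite nrmZ nrm_real normfV -(ltr_pM2l hn) mulrA divff ?lt0r_neq0 // mul1r.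
have bnd z : nrm (expc_on sigma (t + h) z - expc_on sigma t z - h%:C * F z) <= `|h| ^+ 2 * Q.
  rewrite /expc_on /F indicE; have [/set_mem sz|_] := boolP (_ \in _); last first.
    by rewrite !mul0r mulr0 !subr0 nrm0 mulr_ge0 ?sqr_ge0 ?(ltW Q0).
  rewrite !mul1r expcD.
  have -> : expc t z * expc h z - expc t z - h%:C * (z * expc t z) =
    expc t z * (expc h z - 1 - h%:C * z) by ring.
  rewrite nrmM nrm_expc.
  have split_exp (u : R) : 0 <= u <= t -> nrm z ^+ 2 * expR ((s + u) * complex.Re z) <=
    C * expR (t * `|omega|).
    move=> /andP[u0 ut]; rewrite mulrDl expRD mulrA; apply: ler_pM.
    - by rewrite mulr_ge0 ?expR_ge0 // exprn_ge0 // nrm_ge0.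
    - exact: expR_ge0.
    - exact: HC.
    rewrite ler_expR (@le_trans _ _ (u * `|omega|)) ?ler_wpM2r // ler_wpM2l //.
    by rewrite (le_trans (Hw sz)) // ler_norm.
  have u1 : 0 <= s <= t by apply/andP; split; lra.
  have u2 : 0 <= s + h <= t by apply/andP; split; lra.
  have := split_exp _ u1; have := split_exp _ u2; rewrite addrA ss => k1 k2.
  have := expc_sub1z_le h z; rewrite -(ler_pM2l (expR_gt0 (t * complex.Re z))) => k3.
  rewrite (le_trans k3) //.
  rewrite (_ : expR _ * _ = 4 * h ^+ 2 * (nrm z ^+ 2 * expR (t * complex.Re z)
    + nrm z ^+ 2 * expR ((t + h) * complex.Re z))); last first.
    by rewrite (mulrDl t h) expRD; ring.
  rewrite real_normK ?num_real // /Q.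
  have : h ^+ 2 * (nrm z ^+ 2 * expR (t * complex.Re z) + nrm z ^+ 2 * expR ((t + h)
    * complex.Re z)) <=
     h ^+ 2 * (C * expR (t * `|omega|) + C * expR (t * `|omega|))
       by rewrite ler_wpM2l ?sqr_ge0 ?lerD.
  lra.
rewrite (le_lt_trans (HK _ _ l5 bnd f)) //.
have -> : K * (`|h| ^+ 2 * Q) * nrm f = `|h| * (`|h| * (K * Q * nrm f)) by ring.
rewrite ltr_pM2l // (le_lt_trans _ he) // mulrDr mulr1.
by rewrite lerDl.
Qed.

End Generation.

(** * The operators of the semigroup are of scalar type *)

Section ScalarTypeSemigroup.
Context {R : realType} {X : completeNormedModType R[i]}.
Variables (A : operator X) (E : set R[i] -> X -> X).
Hypothesis hE : spectral_measure E.
Hypothesis suppE : Defs.support E = spectrum A.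
Hypothesis AE : forall f y, (dom A f /\ A f = y) <-> is_spectral_integral E (spectrum A) id f y.

Lemma semigroup_scalar_type (T : R -> X -> X) (t : R) :
  C0_semigroup T -> generates A T -> 0 <= t ->
  scalar_type_spectral (everywhere_defined (T t)).
Proof.
move=> hT hgen t0.
have [omega Hw] := spectrum_Re_bounded hE suppE AE hT hgen.
have bs := borel_sigma hE suppE.
have lexp := simple_limit_expc_on bs Hw t0.
(* [T] is an arbitrary semigroup generated by [A]. The two operators agree on the range of each
   [E (Sn n)], and these vectors approximate every [f]. *)
have Tt f : T t f = bint E (expc_on (spectrum A) t) f.
  pose Sn n := spectrum A `&` [set w : R[i] | nrm w <= n%:R].
  have fn := E_sigman_cvg hE suppE (f := f).
  apply: (cvg_seq_unique (bounded_op_cvg (sg_bounded hT t0) fn)).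
  have -> : (fun n => T t (E (Sn n) f)) = (fun n => bint E (expc_on (spectrum A) t) (E (Sn n) f)).
    apply/funext => n.
    have bn := borel_sigman hE suppE n.
    have En : E (Sn n) (E (Sn n) f) = E (Sn n) f by rewrite -(E_setI hE) // setIid.
    have Sr z : Sn n z -> nrm z <= n%:R by case.
    have Ss : Sn n `<=` spectrum A by move=> z [].
    rewrite (semigroup_on_bounded hE suppE AE hT hgen bn Ss Sr t0 En).
    exact/esym/(exp_semigroup_sigman hE suppE Hw).
  exact: (bounded_op_cvg (bint_bounded hE lexp) fn).
have cg := @continuous_expc R t.
pose E' := pushforward_measure E (expc t).
have hE' : spectral_measure E' := spectral_measure_pushforward hE cg.
have sup z : Defs.support E' z -> nrm z <= expR (t * omega).
  move=> Sz; rewrite leNgt; apply/negP => lt.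
  (* This ball avoids the closed disc of radius [e^(t omega)], which contains [e^(tw)] for every [w]
     in the spectrum; its preimage is therefore null. *)
  have zz : cball z (nrm z - expR (t * omega)) z by rewrite /cball /= subrr nrm0 subr_gt0.
  have [f] := Sz _ (@open_cball _ z (nrm z - expR (t * omega))) zz; apply.
  rewrite /E' /pushforward_measure -(E_sigma hE suppE f) -(E_setI hE) //; last first.
    by apply: borel_preimage => //; exact: borel_cball.
  rewrite (_ : _ `&` _ = set0) ?(E_set0 hE) //.
  apply/seteqP; split=> w // [wz sw].
  have := nrm_expc_le Hw t0 sw; have := nrmBl z (expc t w); rewrite nrmBC.
  by move: wz; rewrite /cball /=; lra.
have -> : T t = bint E' (id_on (Defs.support E')).
  apply/funext => f; rewrite Tt.
  have lS := simple_limit_id_on_support hE' sup.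
  have [lS' <-] := bint_pushforward hE cg f lS.
  have bS' : borel (expc t @^-1` Defs.support E' : set R[i]).
    by apply: borel_preimage => //; exact: borel_support.
  apply: (bint_eq_on hE (D := spectrum A `&` (expc t @^-1` Defs.support E'))) => //.
  - exact: borelI.
  - by move=> g; rewrite (E_setI hE) // (E_sigma hE suppE); exact: (E_support hE').
  by move=> z [sz Sz]; rewrite /expc_on /id_on /= !indic_in // !mul1r.
exact: (bounded_support_scalar_type hE' sup).
Qed.

End ScalarTypeSemigroup.

Theorem theorem4p1 (R : realType) (X : completeNormedModType R[i])
    (A : operator X) (hA : scalar_type_spectral A) :
  ((exists T : R -> X -> X,
      [/\ C0_semigroup T, generates A T & immediately_differentiable T]) <->
   (exists omega : R, forall b : R, 0 < b -> exists a : R,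
      spectrum A `<=` log_region omega a b)) /\
  (forall T : R -> X -> X,
      C0_semigroup T -> generates A T -> immediately_differentiable T ->
      forall t : R, 0 <= t -> scalar_type_spectral (everywhere_defined (T t))).
Proof.
case: hA => _ [E [hE suppE AE]]; split; last first.
  by move=> T hT hgen _ t t0; exact: (semigroup_scalar_type hE suppE AE hT hgen).
split=> [[T [hT hgen dT]]|[omega Hlog]].
  exact: (spectrum_in_log_region hE suppE AE hT hgen dT).
have Hw z : spectrum A z -> complex.Re z <= omega.
  (* The half-plane bound is part of the region for each [b]; 1 is an arbitrary choice. *)
  have [a Ha] := Hlog 1 ltr01.
  by move=> /Ha /(log_regionP _ _ _ ltr01)[].
exists (exp_semigroup A E); split.
- exact: (exp_semigroup_C0 hE suppE Hw).
- exact: (exp_semigroup_generates hE suppE AE Hw).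
- exact: (exp_semigroup_differentiable hE suppE Hw Hlog).
Qed.
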